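(* Let $c>0$ and $T_M=\varepsilon$. Then for $\varepsilon<\varepsilon_0$ small enough there exist constants $A>0$ and $c_0\in(0,1)$ and a unique solution $f\in C^{2,1/2}(\mathbb R_+)$ of $$f''(y)-cf'(y)-f^4(y)=-\int_0^\infty E(y-\eta)f^4(\eta)d\eta\ (y>0),\qquad f(0)=T_M,\qquad f\ge0,$$ such that $\lim_{y\to\infty}f(y)=f_\infty$ exists and $|f(y)-f_\infty|\le Ae^{-y/2}$ for all $y\ge0$. Moreover $f(y)\ge c_0\varepsilon$ for all $y\ge0$ and $f_\infty\ge c_0\varepsilon$.
   Context: $E(x)=\frac12\int_{|x|}^\infty\frac{e^{-t}}{t}dt$; $\mathbb R_+=[0,\infty)$; $C^{2,1/2}(\mathbb R_+)$ is the space of $C^2$ functions with bounded derivatives up to order 2 and bounded $1/2$-Hölder seminorm of the second derivative. *)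

(* Defs.v *)
From HB Require Import structures.
From mathcomp Require Import all_boot all_order all_algebra.
From mathcomp Require Import all_classical all_reals all_analysis.
Set Implicit Arguments. Unset Strict Implicit. Unset Printing Implicit Defensive.
Import Order.TTheory GRing.Theory Num.Theory.
Import numFieldNormedType.Exports.
Local Open Scope classical_set_scope.
Local Open Scope ring_scope.

(* Exponential-integral kernel E(x) = 1/2 \int_{|x|}^oo e^{-t}/t dt,
   valued in the extended reals (E(0) = +oo). *)
Definition Ekernel (R : realType) (x : R) : \bar R :=
  ((2^-1)%:E * \int[@lebesgue_measure R]_(t in `[(`|x|)%R, +oo[%classic) (expR (- t) / t)%:E)%E.

(* C^{2,1/2}(R_+): f continuous on [0,oo), twice differentiable on (0,oo),
   f, f', f'' bounded and f'' 1/2-Hoelder on (0,oo)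
   (this makes f', f'' extend continuously to 0). *)
Definition C2half (R : realType) (f : R -> R) : Prop :=
  {within `[0, +oo[, continuous f} /\
  (forall y : R, 0 < y -> derivable f y 1 /\ derivable (derive1 f) y 1) /\
  exists M : R,
    (forall y : R, 0 <= y -> `|f y| <= M) /\
    (forall y : R, 0 < y -> `|(derive1 f) y| <= M /\ `|derive1 (derive1 f) y| <= M) /\
    (forall x y : R, 0 < x -> 0 < y ->
        `|derive1 (derive1 f) x - derive1 (derive1 f) y| <= M * Num.sqrt `|x - y|).

Definition solves_problem (R : realType) (c eps : R) (f : R -> R) : Prop :=
  C2half f /\
  (forall y : R, 0 < y ->
     ((derive1 (derive1 f) y - c * (derive1 f) y - f y ^+ 4)%:E =
      - \int[@lebesgue_measure R]_(eta in `[0%R, +oo[%classic)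
            (Ekernel (y - eta) * (f eta ^+ 4)%:E))%E) /\
  f 0 = eps /\
  (forall y : R, 0 <= y -> 0 <= f y).

(* Main.v *)
Require Import Defs.
From HB Require Import structures.
From mathcomp Require Import all_boot all_order all_algebra.
From mathcomp Require Import all_classical all_reals all_analysis.
From mathcomp Require Import measurable_realfun.
From mathcomp Require Import ring lra.
Set Implicit Arguments. Unset Strict Implicit. Unset Printing Implicit Defensive.
Import Order.TTheory GRing.Theory Num.Theory.
Import numFieldNormedType.Exports.
Local Open Scope classical_set_scope.
Local Open Scope ring_scope.

(* Write h = f^4 and F = h - E * h (convolution over the half-line). A solution with a limit
   f_oo and bounded derivative is characterised by
     f(y) = f_oo + int_y^oo F(s) (1 - e^{-c(s-y)}) / c ds,
   because v = f' - (right-hand side)' satisfies v' = c v and is bounded, hence vanishes.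
   With g = f - f_oo and f_oo = eps - g(0) this is a fixed point equation for g alone.

   E is a probability density on the line with int E(y - s) e^{-s/2} ds <= 2 e^{-y/2}, so the
   deviation of h from its limit, and the mass 1 - int_0^oo E(y - s) ds lost at the boundary,
   both contribute terms of size e^{-y/2} to F. As h is quartic, F is Lipschitz in g with a
   constant O(eps^3) for the norm sup e^{y/2} |g|, and the fixed point map is a contraction of
   the ball of radius eps / 4 for eps small. The L^1 modulus of continuity of E is O(sqrt d),
   so E * h is 1/2-Hoelder, and with it f''. *)

(** The unknown limit is the obstacle. Two candidates with different values of [g 0] have different
    limits, so the difference of their fourth powers does not decay, and no weighted norm controls
    it. It becomes small only after passing through h - E * h: a constant is turned into that
    constant times the mass lost at the boundary, which does decay. Every estimate of [source]
    therefore splits off the limiting constant first. The rate 1/2 suits the kernel because the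
    slice at [t] has mass e^{-t}, while moving the weight over a distance [t] costs only e^{t/2}.
    The radius eps / 4 has two uses. It keeps the profile and its limit above eps / 2, which gives
    nonnegativity and the lower bounds. It is also the constant A, so that the decay condition
    imposed on a competing solution says precisely that this solution lies in the ball where the map
    contracts. Functions on the half-line are extended evenly through [|y|], so that continuity,
    measurability and tails are treated on the whole line; only the differential equation is
    confined to y > 0. *)

Section ExponentialDecay.
Context {R : realType}.
Notation mu := (@lebesgue_measure R).
Implicit Types (lambda a x : R).

Lemma is_derive_expRZ lambda x :
  is_derive x 1 (fun t : R => expR (lambda * t)) (lambda * expR (lambda * x)).
Proof.
have H : is_derive x 1 (fun t : R => lambda * t) lambda.
  by apply: is_derive_eq (is_deriveZ lambda (is_derive_id x 1)) _; rewrite /GRing.scale/= mulr1.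
by apply: is_derive_eq (is_derive1_comp (is_derive_expR _) H) _; rewrite mulrC.
Qed.

Lemma continuous_expRZ lambda : continuous (fun t : R => expR (lambda * t)).
Proof.
move=> x; apply: differentiable_continuous; apply/derivable1_diffP.
by case: (is_derive_expRZ lambda x).
Qed.

Lemma cvg_expRZ_pinfty lambda : 0 < lambda -> expR (- lambda * x) @[x --> +oo] --> (0 : R).
Proof.
move=> l0; under eq_fun do rewrite mulNr.
exact: (cvg_comp _ _ (gt0_cvgMry l0 cvg_id) (@cvgr_expR R)).
Qed.

Lemma integral_expR_itvcy lambda a : 0 < lambda ->
  (\int[mu]_(t in `[a, +oo[) (expR (- lambda * t))%:E = (expR (- lambda * a) / lambda)%:E)%E.
Proof.
move=> l0.
have l0' : lambda != 0 by rewrite gt_eqF.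
have D x : is_derive x 1 (fun t : R => - lambda^-1 * expR (- lambda * t)) (expR (- lambda * x)).
  apply: is_derive_eq (is_deriveZ (- lambda^-1) (is_derive_expRZ (- lambda) x)) _.
  by rewrite /GRing.scale/= mulrA mulrNN mulVf// mul1r.
rewrite (@ge0_continuous_FTC2y _ _ (fun t => - lambda^-1 * expR (- lambda * t)) a 0)//.
- by rewrite -EFinB sub0r mulNr opprK mulrC.
- by apply: continuous_subspaceT; exact: continuous_expRZ.
- rewrite -[X in _ --> X](mulr0 (- lambda^-1)).
  by apply: cvgM; [exact: cvg_cst|exact: cvg_expRZ_pinfty].
- apply: cvg_at_right_filter; apply: cvgM; [exact: cvg_cst|exact: continuous_expRZ].
- by move=> x _; rewrite derive1E derive_val.
Qed.

End ExponentialDecay.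

(** * The exponential-integral kernel *)

Section ExponentialIntegralKernel.
Context {R : realType}.
Notation mu := (@lebesgue_measure R).
Implicit Types (t x y eta : R) (phi : R -> R).

(* The integrand of [Ekernel x] in [t]: the kernel is a mixture of the uniform densities on
   [[- t, t]], so Tonelli reduces its integral estimates to Lebesgue measures of intervals. *)
Definition slice t x : R := if `|x| <= t then 2^-1 * (expR (- t) / t) else 0.

Lemma slice_ge0 t x : 0 <= slice t x.
Proof.
rewrite /slice; case: ifPn => // xt; rewrite mulr_ge0 ?invr_ge0// divr_ge0 ?expR_ge0//.
exact: le_trans xt.
Qed.

(** Both arguments vary over an arbitrary space, since Tonelli asks for joint measurability on the
    product as well as in each variable. *)
Lemma measurable_slice (d : measure_display) (T : measurableType d) (f g : T -> R) :
  measurable_fun setT f -> measurable_fun setT g ->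
  measurable_fun setT (fun z => slice (f z) (g z)).
Proof.
move=> mf mg.
(* On the branch taken [f z] is nonnegative, so its inverse is the real power with exponent -1, a
   measurable function. *)
rewrite (_ : (fun z => _) = fun z =>
    if `|g z| <= f z then 2^-1 * (expR (- f z) * (f z) `^ (-1)) else 0); last first.
  apply/funext => z; rewrite /slice; case: ifPn => // h.
  by rewrite powR_inv1// (le_trans _ h).
apply: measurable_fun_ifT => //.
  by apply: measurable_fun_ler => //; exact: measurableT_comp.
apply: measurable_funM => //; apply: measurable_funM.
  apply: measurableT_comp => //; exact: measurableT_comp.
exact: (measurableT_comp (measurable_powR _)).
Qed.

Lemma EkernelE x : (Ekernel x = \int[mu]_t (slice t x)%:E)%E.
Proof.
rewrite /Ekernel integral_mkcond -ge0_integralZl//.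
- apply: eq_integral => t _; rewrite patchE /slice.
  case: ifPn; rewrite ?inE ?notin_setE /= in_itv /= andbT => h.
    by rewrite h EFinM.
  by move/negP/negbTE: h => ->; rewrite mule0.
- apply: (eq_measurable_fun (fun t => (2 * slice t x)%:E)).
    move=> t _; apply/esym; rewrite patchE /slice.
    case: ifPn; rewrite ?inE ?notin_setE /= in_itv /= andbT => h.
      by rewrite h mulrA divff ?mul1r// pnatr_eq0.
    by move/negP/negbTE: h => ->; rewrite mulr0.
  by apply/measurable_EFinP; apply: measurable_funM => //; apply: measurable_slice.
- move=> t _; rewrite patchE; case: ifPn => //.
  rewrite inE /= in_itv /= andbT => h.
  by rewrite lee_fin divr_ge0 ?expR_ge0 ?(le_trans _ h).
Qed.

Lemma Ekernel_ge0 x : (0 <= Ekernel x)%E.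
Proof. by rewrite EkernelE; apply: integral_ge0 => t _; rewrite lee_fin slice_ge0. Qed.

Lemma measurable_Ekernel : measurable_fun setT (@Ekernel R).
Proof.
have := @measurable_fun_fubini_tonelli_F _ _ (measurableTypeR R) (measurableTypeR R) R mu
  (fun z => (slice z.2 z.1)%:E).
rewrite /fubini_F /= => H.
apply: eq_measurable_fun; last apply: H.
- by move=> x _; rewrite EkernelE.
- by apply/measurable_EFinP; apply: measurable_slice.
- by move=> z; rewrite lee_fin slice_ge0.
Qed.

(** For fixed [t] the inner integral on the right only sees the interval of radius [t] around [y],
    so estimates become elementary in [eta] and are integrated in [t] afterwards. *)
Lemma Ekernel_tonelli y phi : measurable_fun setT phi -> (forall eta, 0 <= phi eta) ->
  (\int[mu]_eta (Ekernel (y - eta) * (phi eta)%:E) =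
   \int[mu]_t \int[mu]_eta (slice t (y - eta) * phi eta)%:E)%E.
Proof.
move=> mphi phi0.
have ms : measurable_fun setT
    (fun z : measurableTypeR R * measurableTypeR R => slice z.2 (y - z.1) * phi z.1).
  apply: measurable_funM; last exact: (measurableT_comp mphi).
  by apply: measurable_slice => //; exact: measurable_funB.
have := @fubini_tonelli _ _ (measurableTypeR R) (measurableTypeR R) R mu mu
  (fun z => (slice z.2 (y - z.1) * phi z.1)%:E).
rewrite /= => <-; last 2 first.
- exact/measurable_EFinP.
- by move=> z; rewrite lee_fin mulr_ge0 ?slice_ge0.
apply: eq_integral => eta _; rewrite EkernelE -ge0_integralZr//.
- by apply/measurable_EFinP; exact: measurable_slice.
- by move=> t _; rewrite lee_fin slice_ge0.
- by rewrite lee_fin.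
Qed.

End ExponentialIntegralKernel.

(** * Mass, weighted integral and almost everywhere finiteness of the kernel *)

Section KernelBounds.
Context {R : realType}.
Notation mu := (@lebesgue_measure R).
Implicit Types (t x y eta : R) (phi : R -> R).

Lemma slice_le0 t x : t <= 0 -> slice t x = 0.
Proof.
move=> t0; rewrite /slice; case: ifPn => // xt.
have -> : t = 0 by apply/le_anti; rewrite t0 (le_trans _ xt).
(* The convention that the inverse of 0 is 0 makes the slice at [t = 0] vanish. *)
by rewrite invr0 mulr0 mulr0.
Qed.

Lemma slice_itv t y eta :
  slice t (y - eta) = 2^-1 * (expR (- t) / t) * \1_(`[y - t, y + t]%classic) eta.
Proof.
rewrite /slice indicE ler_norml.
case: ifPn => [/andP[h1 h2]|h].
  rewrite mem_set ?mulr1//= in_itv/=; apply/andP; split; lra.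
rewrite memNset ?mulr0//= in_itv/=; apply/negP; move: h; apply: contra => /andP[h1 h2].
apply/andP; split; lra.
Qed.

(** The interval has length [2 * t], which cancels the factor 1 / (2 t) of the density. *)
Lemma integral_slice t y :
  (\int[mu]_eta (slice t (y - eta))%:E = (if 0 < t then expR (- t) else 0)%:E)%E.
Proof.
case: ltP => [t0|t0]; last first.
  by apply: integral0_eq => eta _; rewrite slice_le0.
have mI : mu (`[y - t, y + t]%classic) = (2 * t)%:E.
  rewrite lebesgue_measure_itv/= lte_fin ifT; last by lra.
  by rewrite -EFinB; congr (_%:E); ring.
under eq_integral do rewrite slice_itv EFinM.
rewrite ge0_integralZl//.
- transitivity ((2^-1 * (expR (- t) / t))%:E * (2 * t)%:E)%E; last first.
    by rewrite -EFinM; congr (_%:E); field; rewrite gt_eqF.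
  congr (_ * _)%E; rewrite integral_indic// setIT; exact: mI.
- exact/measurable_EFinP.
- by rewrite lee_fin mulr_ge0// ?invr_ge0// divr_ge0 ?expR_ge0// ltW.
Qed.

Lemma integral_pos_expR (lambda : R) : 0 < lambda ->
  (\int[mu]_t (if 0 < t then expR (- lambda * t) else 0)%:E = (lambda^-1)%:E)%E.
Proof.
move=> l0; have := @integral_expR_itvcy _ _ 0 l0.
rewrite mulr0 expR0 div1r => <-.
rewrite -integral_itv_obnd_cbnd; last first.
  apply/measurable_EFinP; apply: measurable_funTS.
  by apply: continuous_measurable_fun; exact: continuous_expRZ.
rewrite [RHS]integral_mkcond; apply: eq_integral => t _; rewrite patchE.
case: ltP => t0; first by rewrite mem_set//= in_itv/= andbT.
by rewrite memNset//= in_itv/= andbT; apply/negP; rewrite -leNgt.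
Qed.

Lemma measurable_shift_Ekernel y : measurable_fun setT (fun eta => Ekernel (y - eta)).
Proof. by apply: (measurableT_comp (@measurable_Ekernel R)); exact: measurable_funB. Qed.

Lemma Ekernel_mass y : (\int[mu]_eta (Ekernel (y - eta)) = 1)%E.
Proof.
transitivity (\int[mu]_eta (Ekernel (y - eta) * (cst 1 eta)%:E))%E.
  by apply: eq_integral => eta _; rewrite mule1.
rewrite Ekernel_tonelli//.
transitivity (\int[mu]_t (if (0 < t)%R then expR (- 1 * t) else 0)%:E)%E.
  apply: eq_integral => t _; under eq_integral do rewrite mulr1.
  by rewrite integral_slice mulN1r.
by rewrite integral_pos_expR// invr1.
Qed.

Lemma measurable_slice_integral y phi : measurable_fun setT phi -> (forall eta, 0 <= phi eta) ->
  measurable_fun setT (fun t => \int[mu]_eta (slice t (y - eta) * phi eta)%:E)%E.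
Proof.
move=> mphi phi0.
have := @measurable_fun_fubini_tonelli_F _ _ (measurableTypeR R) (measurableTypeR R) R mu
  (fun z => (slice z.1 (y - z.2) * phi z.2)%:E).
rewrite /fubini_F /=; apply.
- apply/measurable_EFinP; apply: measurable_funM; last exact: (measurableT_comp mphi).
  by apply: measurable_slice => //; exact: measurable_funB.
- by move=> z; rewrite lee_fin mulr_ge0 ?slice_ge0.
Qed.

(** On the support of the slice [eta >= y - t], so the weight is at most e^{-y/2} e^{t/2}. Against
    the slice mass e^{-t} this leaves e^{-t/2}, whose integral over t > 0 is the factor 2. *)
Lemma Ekernel_weighted y :
  (\int[mu]_eta (Ekernel (y - eta) * (expR (- 2^-1 * eta))%:E) <= (2 * expR (- 2^-1 * y))%:E)%E.
Proof.
have mexp : measurable_fun setT (fun eta : R => expR (- 2^-1 * eta)).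
  by apply: continuous_measurable_fun; exact: continuous_expRZ.
rewrite Ekernel_tonelli//.
pose g (t : R) := if 0 < t then expR (- 2^-1 * t) else 0.
have mg : measurable_fun setT g by apply: measurable_fun_ifT => //; exact: measurable_fun_ltr.
apply: (@le_trans _ _ (\int[mu]_t ((expR (- 2^-1 * y))%:E * (g t)%:E))%E); last first.
  rewrite ge0_integralZl//; last 2 first.
  - exact/measurable_EFinP.
  - by move=> t _; rewrite /g lee_fin; case: ifPn => // _; rewrite expR_ge0.
  by rewrite integral_pos_expR ?invr_gt0// invrK -EFinM mulrC.
apply: ge0_le_integral => //.
- by move=> t _; apply: integral_ge0 => eta _; rewrite lee_fin mulr_ge0 ?slice_ge0 ?expR_ge0.
- by apply: measurable_slice_integral => // eta; exact: expR_ge0.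
- by apply/measurable_EFinP; exact: measurable_funM.
move=> t _.
apply: (@le_trans _ _ (\int[mu]_eta ((expR (- 2^-1 * (y - t)))%:E * (slice t (y - eta))%:E))%E).
  apply: ge0_le_integral => //.
  - by move=> eta _; rewrite lee_fin mulr_ge0 ?slice_ge0 ?expR_ge0.
  - apply/measurable_EFinP; apply: measurable_funM => //.
    by apply: measurable_slice => //; exact: measurable_funB.
  - apply/measurable_EFinP; apply: measurable_funM => //.
    by apply: measurable_slice => //; exact: measurable_funB.
  move=> eta _; rewrite -EFinM lee_fin mulrC.
  have [h|h] := boolP (`|y - eta| <= t).
    rewrite ler_wpM2r ?slice_ge0// ler_expR.
    by move: h; rewrite ler_norml => /andP[h1 h2]; lra.
  by rewrite /slice (negbTE h) !mulr0.
rewrite ge0_integralZl//; last 2 first.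
- apply/measurable_EFinP.
  by apply: measurable_slice => //; exact: measurable_funB.
- by move=> eta _; rewrite lee_fin slice_ge0.
rewrite integral_slice /g -!EFinM lee_fin; case: ifPn => _; last by rewrite !mulr0.
by rewrite -!expRD ler_expR; lra.
Qed.

(** [fine] sends the value +oo to 0; integrals do not notice, because that value is taken on a null
    set only. *)
Definition rkernel x : R := fine (Ekernel x).

Lemma rkernel_ge0 x : 0 <= rkernel x.
Proof. by rewrite fine_ge0// Ekernel_ge0. Qed.

Lemma integrable_Ekernel y : mu.-integrable setT (fun eta => Ekernel (y - eta)).
Proof.
apply/integrableP; split; first exact: measurable_shift_Ekernel.
under eq_integral do rewrite gee0_abs ?Ekernel_ge0//.
by rewrite Ekernel_mass ltry.
Qed.

(** Finiteness follows from the total mass being 1, since an integrable function is finite almost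
    everywhere. *)
Lemma Ekernel_ae_fin y : {ae mu, forall eta, Ekernel (y - eta) \is a fin_num}.
Proof.
by apply: filterS (integrable_ae measurableT (integrable_Ekernel y)) => eta; exact.
Qed.

Lemma measurable_rkernel y : measurable_fun setT (fun eta => rkernel (y - eta)).
Proof. exact: (measurableT_comp _ (measurable_shift_Ekernel y)). Qed.

Lemma integral_Ekernel_rkernel (D : set R) y phi : measurable D -> measurable_fun D phi ->
  (\int[mu]_(eta in D) (Ekernel (y - eta) * (phi eta)%:E) =
   \int[mu]_(eta in D) (rkernel (y - eta) * phi eta)%:E)%E.
Proof.
move=> mD mphi; apply: ae_eq_integral => //.
- apply: emeasurable_funM; last exact/measurable_EFinP.
  by apply: measurable_funTS; exact: measurable_shift_Ekernel.
- apply/measurable_EFinP; apply: measurable_funM => //.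
  by apply: measurable_funTS; exact: measurable_rkernel.
- have := Ekernel_ae_fin y; apply: filterS; first exact: (ae_filter_ringOfSetsType mu).
  move=> eta fin _.
  by rewrite EFinM /rkernel fineK.
Qed.

Lemma rkernel_mass y : (\int[mu]_eta (rkernel (y - eta))%:E = 1)%E.
Proof.
rewrite -(Ekernel_mass y).
have := @integral_Ekernel_rkernel setT y (cst 1) measurableT (measurable_cst _).
by under eq_integral do rewrite mule1; under [RHS]eq_integral do rewrite mulr1.
Qed.

Lemma integrable_rkernel y : mu.-integrable setT (fun eta => (rkernel (y - eta))%:E).
Proof.
apply/integrableP; split; first by apply/measurable_EFinP; exact: measurable_rkernel.
under eq_integral do rewrite gee0_abs ?lee_fin ?rkernel_ge0//.
by rewrite rkernel_mass ltry.
Qed.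

End KernelBounds.

(** * Translation of the kernel in L^1 *)

Section KernelModulus.
Context {R : realType}.
Notation mu := (@lebesgue_measure R).
Implicit Types (t x y eta : R).

(** Intervals of radius [t] around [x] and [y] can differ only in two end pieces, each of length
    [y - x]. *)
Lemma slice_diff_itv t x y eta : 0 <= t -> x <= y ->
  `|slice t (x - eta) - slice t (y - eta)| <=
  2^-1 * (expR (- t) / t) *
  (\1_(`[x - t, y - t]%classic) eta + \1_(`[x + t, y + t]%classic) eta).
Proof.
move=> t0 xy.
have k0 : 0 <= 2^-1 * (expR (- t) / t) by rewrite mulr_ge0// divr_ge0 ?expR_ge0.
have pos (A : set R) : 0 <= (\1_A eta : R) by rewrite indicE.
have R0 : 0 <= 2^-1 * (expR (- t) / t) *
  (\1_(`[x - t, y - t]%classic) eta + \1_(`[x + t, y + t]%classic) eta).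
  by rewrite mulr_ge0// addr_ge0.
have sub (A : set R) : A eta -> \1_A eta = 1 :> R by move=> h; rewrite indicE mem_set.
have B z : (`|z| <= t) = (- t <= z <= t) by exact: ler_norml.
rewrite {1 2}/slice !B.
case: ifPn => [/andP[x1 x2]|hx]; case: ifPn => [/andP[y1 y2]|hy].
- by rewrite subrr normr0.
- rewrite subr0 ger0_norm// ler_peMr// (sub `[x - t, y - t]%classic) ?lerDl//=.
  rewrite in_itv/=; apply/andP; split; first lra.
  rewrite leNgt; apply: contra hy => hy; apply/andP; split; lra.
- rewrite sub0r normrN ger0_norm// ler_peMr// (sub `[x + t, y + t]%classic) ?lerDr//=.
  rewrite in_itv/=; apply/andP; split; last lra.
  rewrite leNgt; apply: contra hx => hx; apply/andP; split; lra.
- by rewrite subrr normr0.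
Qed.

(** The cut is at t = s with s = sqrt(y - x). For t <= s the triangle inequality bounds the integral
    by the two masses, at most 2. For t > s the end pieces of length s^2, times the density, give
    e^{-t} s^2 / t <= s e^{-t}. Integrated in [t], the two regimes contribute 2 s and s, which is
    the source of the exponent 1/2. *)
Lemma integral_slice_diff t x y : x <= y ->
  (\int[mu]_eta (`|slice t (x - eta) - slice t (y - eta)|)%:E <=
   (2 * \1_(`]0, Num.sqrt (y - x)]%classic) t)%:E +
   (Num.sqrt (y - x) * (if (0 < t)%R then expR (- 1 * t) else 0))%:E)%E.
Proof.
move=> xy; set s := Num.sqrt (y - x).
have s0 : 0 <= s by exact: sqrtr_ge0.
have s2 : s ^+ 2 = y - x by rewrite sqr_sqrtr// subr_ge0.
have ms z : measurable_fun setT (fun eta => slice t (z - eta)).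
  by apply: measurable_slice => //; exact: measurable_funB.
have md : measurable_fun setT (fun eta => (`|slice t (x - eta) - slice t (y - eta)|)%:E).
  apply/measurable_EFinP; apply: measurableT_comp => //.
  by apply: measurable_funB; exact: ms.
have [t0|t0] := leP t 0.
  rewrite integral0_eq; last by move=> eta _; rewrite !slice_le0// subrr normr0.
  by rewrite -EFinD lee_fin mulr0 addr0 mulr_ge0// indicE.
have [ts|st] := leP t s.
  apply: (@le_trans _ _ (\int[mu]_eta ((slice t (x - eta))%:E + (slice t (y - eta))%:E))%E).
    apply: ge0_le_integral => //.
    - by apply/measurable_EFinP; apply: measurable_funD; exact: ms.
    - move=> eta _; rewrite lee_fin (le_trans (ler_normB _ _))//.
      by rewrite !ger0_norm ?slice_ge0.
  rewrite ge0_integralD//; last 4 first.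
  - by move=> eta _; rewrite lee_fin slice_ge0.
  - by apply/measurable_EFinP; exact: ms.
  - by move=> eta _; rewrite lee_fin slice_ge0.
  - by apply/measurable_EFinP; exact: ms.
  rewrite !integral_slice t0 -!EFinD lee_fin indicE mem_set/=; last by rewrite in_itv/= t0.
  have : expR (- t) <= 1 by rewrite expR_le1; lra.
  have : 0 <= s * expR (- 1 * t) by rewrite mulr_ge0 ?expR_ge0.
  lra.
apply: (@le_trans _ _ (\int[mu]_eta ((2^-1 * (expR (- t) / t))%:E *
  ((\1_(`[x - t, y - t]%classic) eta)%:E + (\1_(`[x + t, y + t]%classic) eta)%:E)))%E).
  apply: ge0_le_integral => //.
  - apply/measurable_EFinP; apply: measurable_funM => //.
    by apply: measurable_funD.
  - by move=> eta _; rewrite -EFinD -EFinM lee_fin slice_diff_itv// ltW.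
have k0 : 0 <= 2^-1 * (expR (- t) / t).
  by rewrite mulr_ge0// divr_ge0 ?expR_ge0// ltW.
rewrite ge0_integralZl//; last 2 first.
- by apply/measurable_EFinP; apply: measurable_funD.
- by move=> eta _; rewrite adde_ge0// lee_fin indicE.
rewrite ge0_integralD//; last 2 first.
- exact/measurable_EFinP.
- exact/measurable_EFinP.
have I z : (\int[mu]_eta (\1_(`[(x + z)%R, (y + z)%R]%classic) eta)%:E <= (y - x)%:E)%E.
  have mI : (mu (`[(x + z)%R, (y + z)%R]%classic) <= (y - x)%:E)%E.
    rewrite lebesgue_measure_itv/= lte_fin; case: ifPn => _.
      by rewrite -EFinB lee_fin; lra.
    by rewrite lee_fin; lra.
  by rewrite integral_indic// setIT; exact: mI.
apply: (@le_trans _ _ ((2^-1 * (expR (- t) / t))%:E * ((y - x)%:E + (y - x)%:E))%E).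
  by apply: lee_wpmul2l => //; apply: leeD; exact: I.
rewrite -!EFinD -EFinM lee_fin -s2 mulN1r.
apply: (@le_trans _ _ (s * expR (- t))); last first.
  by rewrite lerDr mulr_ge0// indicE.
have -> : 2^-1 * (expR (- t) / t) * (s ^+ 2 + s ^+ 2) = s * expR (- t) * (s / t).
  by field; rewrite gt_eqF.
rewrite ler_piMr// ?mulr_ge0 ?expR_ge0//.
by rewrite ler_pdivrMr// mul1r ltW.
Qed.

Lemma integrable_slice x : Ekernel x \is a fin_num ->
  mu.-integrable setT (fun t => (slice t x)%:E).
Proof.
rewrite EkernelE => fin; apply/integrableP; split.
  by apply/measurable_EFinP; exact: measurable_slice.
under eq_integral do rewrite gee0_abs ?lee_fin ?slice_ge0//.
by rewrite -ge0_fin_numE//; apply: integral_ge0 => t _; rewrite lee_fin slice_ge0.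
Qed.

Lemma rkernel_diff_le x y : Ekernel x \is a fin_num -> Ekernel y \is a fin_num ->
  ((`|rkernel x - rkernel y|)%:E <= \int[mu]_t (`|slice t x - slice t y|)%:E)%E.
Proof.
move=> finx finy.
have ix := integrable_slice finx; have iy := integrable_slice finy.
have -> : rkernel x - rkernel y = (\int[mu]_t (slice t x - slice t y))%R.
  by rewrite RintegralB// /rkernel !EkernelE.
have ib : mu.-integrable setT (EFin \o (fun t => slice t x - slice t y)).
  exact: (integrableB measurableT ix iy).
rewrite EFin_normr_Rintegral//; apply: le_abse_integral => //.
exact: measurable_int ib.
Qed.

Lemma rkernel_modulus x y :
  (\int[mu]_eta (`|rkernel (x - eta) - rkernel (y - eta)|)%:E <=
   (3 * Num.sqrt `|x - y|)%:E)%E.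
Proof.
wlog xy : x y / x <= y.
  move=> H; have [xy|/ltW yx] := leP x y; first exact: H.
  rewrite distrC; under eq_integral do rewrite distrC; exact: H.
rewrite distrC ger0_norm ?subr_ge0//.
have msd : measurable_fun setT (fun z : measurableTypeR R * measurableTypeR R =>
    `|slice z.2 (x - z.1) - slice z.2 (y - z.1)|).
  apply: measurableT_comp => //.
  by apply: measurable_funB; apply: measurable_slice => //; exact: measurable_funB.
apply: (@le_trans _ _ (\int[mu]_eta \int[mu]_t (`|slice t (x - eta) - slice t (y - eta)|)%:E)%E).
  (* The pointwise bound subtracts two integrals, so both kernel values must be finite; this holds
     for almost every [eta]. *)
  apply: ae_ge0_le_integral => //.
  - apply/measurable_EFinP; apply: measurableT_comp => //.
    by apply: measurable_funB; exact: measurable_rkernel.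
  - by move=> eta _; apply: integral_ge0.
  - have := @measurable_fun_fubini_tonelli_F _ _ (measurableTypeR R) (measurableTypeR R) R mu
      (fun z => (`|slice z.2 (x - z.1) - slice z.2 (y - z.1)|)%:E).
    by rewrite /fubini_F /=; apply => //; exact/measurable_EFinP.
  - have := Ekernel_ae_fin y; have := Ekernel_ae_fin x.
    apply: filterS2; first exact: (ae_filter_ringOfSetsType mu).
    by move=> eta fx fy _; exact: rkernel_diff_le.
have := @fubini_tonelli _ _ (measurableTypeR R) (measurableTypeR R) R mu mu
  (fun z => (`|slice z.2 (x - z.1) - slice z.2 (y - z.1)|)%:E).
rewrite /= => ->//; last exact/measurable_EFinP.
set s := Num.sqrt (y - x).
have s0 : 0 <= s by exact: sqrtr_ge0.
have mind : measurable_fun setT (fun t : R => if 0 < t then expR (- 1 * t) else 0).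
  apply: measurable_fun_ifT => //; first exact: measurable_fun_ltr.
  by apply: continuous_measurable_fun; exact: continuous_expRZ.
have pexp (t : R) : 0 <= (if 0 < t then expR (- 1 * t) else 0).
  by case: ifPn => // _; rewrite expR_ge0.
apply: (@le_trans _ _ (\int[mu]_t ((2%:E * (\1_(`]0, s]%classic) t)%:E) +
   (s%:E * (if (0 < t)%R then expR (- 1 * t) else 0)%:E)))%E).
  apply: ge0_le_integral => //.
  - by move=> t _; apply: integral_ge0.
  - have := @measurable_fun_fubini_tonelli_G _ _ (measurableTypeR R) (measurableTypeR R) R mu
      (fun z => (`|slice z.2 (x - z.1) - slice z.2 (y - z.1)|)%:E).
    by rewrite /fubini_G /=; apply => //; exact/measurable_EFinP.
  - by apply/measurable_EFinP; apply: measurable_funD; apply: measurable_funM.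
  - by move=> t _; rewrite -!EFinM; exact: integral_slice_diff.
rewrite ge0_integralD//; last 3 first.
- by apply/measurable_EFinP; apply: measurable_funM.
- by move=> t _; rewrite lee_fin mulr_ge0.
- by apply/measurable_EFinP; apply: measurable_funM.
rewrite ge0_integralZl//; last exact/measurable_EFinP.
rewrite ge0_integralZl//; last 2 first.
- exact/measurable_EFinP.
- by move=> t _; rewrite lee_fin.
rewrite integral_pos_expR// invr1 mule1.
have mI : (mu (`]0%R, s]%classic) <= s%:E)%E.
  rewrite lebesgue_measure_itv/= lte_fin; case: ifPn => _; last by rewrite lee_fin.
  by rewrite sube0.
have : (\int[mu]_t (\1_(`]0%R, s]%classic) t)%:E <= s%:E)%E.
  by rewrite integral_indic// setIT; exact: mI.
move=> H; apply: (@le_trans _ _ (2%:E * s%:E + s%:E)%E).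
  by apply: leeD => //; exact: lee_wpmul2l.
by rewrite -EFinM -EFinD lee_fin; lra.
Qed.

End KernelModulus.

(** * Convolution with the kernel over the half-line *)

Section HalfLineConvolution.
Context {R : realType}.
Notation mu := (@lebesgue_measure R).
Implicit Types (x y eta B D : R) (h : R -> R).

Section Domination.
Variables (D : set R) (f g : R -> R) (K : R).
Hypotheses (mD : measurable D) (mf : measurable_fun D f) (mg : measurable_fun setT g).
Hypotheses (g0 : forall x, 0 <= g x) (fg : forall x, D x -> `|f x| <= g x).
Hypothesis gK : (\int[mu]_x (g x)%:E <= K%:E)%E.

Let integral_abs_le : (\int[mu]_(x in D) `|(f x)%:E| <= K%:E)%E.
Proof.
apply: le_trans gK; apply: (@le_trans _ _ (\int[mu]_(x in D) (g x)%:E)%E).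
  apply: ge0_le_integral => //.
  - by apply: measurableT_comp => //; exact/measurable_EFinP.
  - by apply/measurable_EFinP; exact: measurable_funTS.
  apply: ge0_subset_integral => //.
  - exact/measurable_EFinP.
  - by move=> x _; rewrite lee_fin.
Qed.

Lemma integrable_dominated : mu.-integrable D (EFin \o f).
Proof.
apply/integrableP; split; first exact/measurable_EFinP.
exact: le_lt_trans integral_abs_le (ltry _).
Qed.

Lemma Rintegral_dominated : `|\int[mu]_(x in D) f x| <= K.
Proof.
rewrite -lee_fin EFin_normr_Rintegral//; last exact: integrable_dominated.
by apply: le_trans integral_abs_le; apply: le_abse_integral => //; exact/measurable_EFinP.
Qed.

End Domination.

Definition halfconv h y : R := (\int[mu]_(eta in `[0, +oo[) (rkernel (y - eta) * h eta))%R.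

Lemma measurable_rkernelM y h : measurable_fun setT h ->
  measurable_fun setT (fun eta : R => rkernel (y - eta) * h eta).
Proof. by move=> mh; apply: measurable_funM => //; exact: measurable_rkernel. Qed.

Lemma integrable_rkernelM y h B : measurable_fun setT h ->
  (forall eta, 0 <= eta -> `|h eta| <= B) ->
  mu.-integrable `[0, +oo[%classic (EFin \o (fun eta => rkernel (y - eta) * h eta)).
Proof.
move=> mh hB; have B0 : 0 <= B by apply: le_trans (hB 0 _).
apply: (@integrable_dominated _ _ (fun eta => rkernel (y - eta) * B) B) => //.
- by apply: measurable_funTS; exact: measurable_rkernelM.
- exact: measurable_rkernelM.
- by move=> eta; rewrite mulr_ge0 ?rkernel_ge0.
- move=> eta /=; rewrite in_itv/= andbT => eta0.
  by rewrite normrM ger0_norm ?rkernel_ge0// ler_wpM2l ?rkernel_ge0// hB.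
- under eq_integral do rewrite EFinM.
  rewrite ge0_integralZr//.
  + by rewrite rkernel_mass mul1e.
  + by apply/measurable_EFinP; exact: measurable_rkernel.
  + by move=> eta _; rewrite lee_fin rkernel_ge0.
Qed.

(** Bridge from the extended-real integral of the equation to [halfconv]; boundedness of [h] makes
    the integral finite, so that [fine] loses nothing. *)
Lemma halfconvE y h B : measurable_fun setT h ->
  (forall eta, 0 <= eta -> `|h eta| <= B) ->
  (\int[mu]_(eta in `[0%R, +oo[) (Ekernel (y - eta) * (h eta)%:E) = (halfconv h y)%:E)%E.
Proof.
move=> mh hB; rewrite integral_Ekernel_rkernel//; last exact: measurable_funTS.
rewrite /halfconv /Rintegral fineK//.
exact: (integrable_fin_num _ (integrable_rkernelM y mh hB)).
Qed.

Lemma halfconvB y h1 h2 B : measurable_fun setT h1 ->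
  measurable_fun setT h2 ->
  (forall eta, 0 <= eta -> `|h1 eta| <= B) -> (forall eta, 0 <= eta -> `|h2 eta| <= B) ->
  halfconv (fun eta => h1 eta - h2 eta) y = halfconv h1 y - halfconv h2 y.
Proof.
move=> m1 m2 b1 b2; rewrite /halfconv -RintegralB//; last 2 first.
- exact: integrable_rkernelM b1.
- exact: integrable_rkernelM b2.
by apply: eq_Rintegral => eta _; rewrite mulrBr.
Qed.

Lemma rkernel_weighted y :
  (\int[mu]_eta (rkernel (y - eta) * expR (- 2^-1 * eta))%:E <= (2 * expR (- 2^-1 * y))%:E)%E.
Proof.
rewrite -integral_Ekernel_rkernel//; first exact: Ekernel_weighted.
by apply: continuous_measurable_fun; exact: continuous_expRZ.
Qed.

Lemma halfconv_weighted y h D : measurable_fun setT h ->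
  (forall eta, 0 <= eta -> `|h eta| <= D * expR (- 2^-1 * eta)) ->
  `|halfconv h y| <= 2 * D * expR (- 2^-1 * y).
Proof.
move=> mh hD.
have D0 : 0 <= D.
  by have := le_trans (normr_ge0 _) (hD 0 (lexx _)); rewrite mulr0 expR0 mulr1.
have mexp : measurable_fun setT (fun eta : R => expR (- 2^-1 * eta)).
  by apply: continuous_measurable_fun; exact: continuous_expRZ.
apply: (@Rintegral_dominated _ _ (fun eta => D * (rkernel (y - eta) * expR (- 2^-1 * eta)))) => //.
- by apply: measurable_funTS; exact: measurable_rkernelM.
- by apply: measurable_funM => //; exact: measurable_rkernelM.
- by move=> eta; rewrite !mulr_ge0 ?rkernel_ge0 ?expR_ge0.
- move=> eta /=; rewrite in_itv/= andbT => eta0.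
  by rewrite normrM ger0_norm ?rkernel_ge0// mulrCA ler_wpM2l ?rkernel_ge0// hD.
- under eq_integral do rewrite EFinM.
  rewrite ge0_integralZl//; last 2 first.
  + by apply/measurable_EFinP; exact: measurable_rkernelM.
  + by move=> eta _; rewrite lee_fin mulr_ge0 ?rkernel_ge0 ?expR_ge0.
  rewrite (_ : 2 * D * _ = D * (2 * expR (- 2^-1 * y))); last by ring.
  by rewrite EFinM lee_wpmul2l ?lee_fin//; exact: rkernel_weighted.
Qed.

(** The defect is the mass that the kernel puts on the negative half-line. There e^{-eta/2} >= 1, so
    the weighted bound, valid on the whole line, applies directly. *)
Lemma halfconv1_defect y : `|1 - halfconv (cst 1) y| <= 2 * expR (- 2^-1 * y).
Proof.
have mexp : measurable_fun setT (fun eta : R => expR (- 2^-1 * eta)).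
  by apply: continuous_measurable_fun; exact: continuous_expRZ.
have ik := integrable_rkernel y.
have H1 : (\int[mu]_(eta in `]-oo, +oo[) rkernel (y - eta))%R = 1.
  by rewrite set_itvNyy /Rintegral rkernel_mass.
have H2 : halfconv (cst 1) y = (\int[mu]_(eta in `]0%R, +oo[) rkernel (y - eta))%R.
  rewrite /halfconv Rintegral_itv_obnd_cbnd; last exact: (integrableS measurableT).
  by apply: eq_Rintegral => eta _; rewrite mulr1.
have ik' : mu.-integrable `]-oo, +oo[%classic (EFin \o (fun eta => rkernel (y - eta))).
  by rewrite set_itvNyy.
have := @Rintegral_itvB _ (fun eta => rkernel (y - eta)) -oo%O +oo%O 0 ik' isT isT.
rewrite H1 -H2 => <-; rewrite opprB addrC subrK.
apply: (@Rintegral_dominated _ _ (fun eta => rkernel (y - eta) * expR (- 2^-1 * eta))) => //.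
- by apply: measurable_funTS; exact: measurable_rkernel.
- exact: measurable_rkernelM.
- by move=> eta; rewrite !mulr_ge0 ?rkernel_ge0 ?expR_ge0.
- move=> eta /=; rewrite in_itv/= => eta0.
  rewrite ger0_norm ?rkernel_ge0// ler_peMr ?rkernel_ge0//.
  by rewrite -[leLHS]expR0 ler_expR; lra.
- exact: rkernel_weighted.
Qed.

Lemma halfconv_holder x y h B : measurable_fun setT h ->
  (forall eta, 0 <= eta -> `|h eta| <= B) ->
  `|halfconv h x - halfconv h y| <= 3 * B * Num.sqrt `|x - y|.
Proof.
move=> mh hB; have B0 : 0 <= B by apply: le_trans (hB 0 _).
have md : measurable_fun setT (fun eta : R => `|rkernel (x - eta) - rkernel (y - eta)|).
  apply: measurableT_comp => //.
  by apply: measurable_funB; exact: measurable_rkernel.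
rewrite /halfconv -RintegralB//; last 2 first.
- exact: integrable_rkernelM hB.
- exact: integrable_rkernelM hB.
apply: (@Rintegral_dominated _ _ (fun eta => B * `|rkernel (x - eta) - rkernel (y - eta)|)) => //.
- by apply: measurable_funTS; apply: measurable_funB; exact: measurable_rkernelM.
- exact: measurable_funM.
- by move=> eta; rewrite mulr_ge0.
- move=> eta /=; rewrite in_itv/= andbT => eta0.
  by rewrite -mulrBl normrM mulrC ler_wpM2r// hB.
- under eq_integral do rewrite EFinM.
  rewrite ge0_integralZl//; last exact/measurable_EFinP.
  rewrite (_ : 3 * B * _ = B * (3 * Num.sqrt `|x - y|)); last by ring.
  by rewrite EFinM lee_wpmul2l ?lee_fin//; exact: rkernel_modulus.
Qed.

End HalfLineConvolution.

(** * Bounded solutions of u'' - c u' = F *)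

Section TailIntegral.
Context {R : realType}.
Notation mu := (@lebesgue_measure R).
Implicit Types (G : R -> R) (B lambda a y : R).

Definition tail G y : R := (\int[mu]_(s in `[y, +oo[) G s)%R.

(** Required for every real [s], where the bound grows towards -oo, so that tails may start at any
    point. *)
Definition exp_bounded B lambda G := forall s : R, `|G s| <= B * expR (- lambda * s).

Lemma integrable_expR_itvcy B lambda a : 0 < lambda ->
  mu.-integrable `[a, +oo[%classic (EFin \o (fun s : R => B * expR (- lambda * s))).
Proof.
move=> l0; apply/integrableP; split.
  apply/measurable_EFinP; apply: measurable_funTS; apply: measurable_funM => //.
  by apply: continuous_measurable_fun; exact: continuous_expRZ.
have -> : (\int[mu]_(x in `[a, +oo[) `|(EFin \o (fun s : R => (B * expR (- lambda * s))%R)) x| =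
    `|B|%:E * (expR (- lambda * a) / lambda)%:E)%E.
  rewrite -integral_expR_itvcy// -ge0_integralZl//.
  - by apply: eq_integral => x _; rewrite /= normrM (ger0_norm (expR_ge0 _)).
  - apply/measurable_EFinP; apply: measurable_funTS.
    by apply: continuous_measurable_fun; exact: continuous_expRZ.
by rewrite -EFinM ltry.
Qed.

Lemma integrable_tail G B lambda a : 0 < lambda -> continuous G -> exp_bounded B lambda G ->
  mu.-integrable `[a, +oo[%classic (EFin \o G).
Proof.
move=> l0 cG GB; apply: le_integrable (integrable_expR_itvcy B a l0) => //.
- apply/measurable_EFinP; apply: measurable_funTS; exact: continuous_measurable_fun.
- by move=> s _; rewrite lee_fin (le_trans (GB s))// ler_norm.
Qed.

Lemma tail_bound G B lambda y : 0 < lambda -> continuous G -> exp_bounded B lambda G ->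
  `|tail G y| <= B / lambda * expR (- lambda * y).
Proof.
move=> l0 cG GB; have iG := integrable_tail y l0 cG GB.
apply: le_trans (le_normr_Rintegral _ iG) _ => //.
apply: (@le_trans _ _ (\int[mu]_(s in `[y, +oo[) (B * expR (- lambda * s)))%R).
  apply: le_Rintegral => //.
  - exact: integrable_norm iG.
  - exact: integrable_expR_itvcy.
rewrite RintegralZl//; last first.
  have := @integrable_expR_itvcy 1 lambda y l0; apply: eq_integrable => // s _ /=.
  by rewrite mul1r.
rewrite /Rintegral integral_expR_itvcy//=.
by rewrite mulrA mulrAC.
Qed.

Lemma tailB G1 G2 B lambda y : 0 < lambda -> continuous G1 -> continuous G2 ->
  exp_bounded B lambda G1 -> exp_bounded B lambda G2 ->
  tail (fun s => G1 s - G2 s) y = tail G1 y - tail G2 y.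
Proof.
move=> l0 c1 c2 b1 b2; rewrite /tail RintegralB//.
- exact: integrable_tail b1.
- exact: integrable_tail b2.
Qed.

(** Near [y], [tail G] is a constant minus an integral starting at [y - 1], to which the fundamental
    theorem of calculus on a bounded interval applies. *)
Lemma is_derive_tail G B lambda y : 0 < lambda -> continuous G -> exp_bounded B lambda G ->
  is_derive y 1 (tail G) (- G y).
Proof.
move=> l0 cG GB; have iG a := integrable_tail a l0 cG GB.
pose I z := (\int[mu]_(s in `[(y - 1)%R, z]) G s)%R.
have D : is_derive y 1 I (G y).
  have [||||dI eI] := @continuous_FTC1_closed _ G (y - 1) y (y + 1).
  - by rewrite ltrDl.
  - by apply: integrableS (iG (y - 1)) => // s /=; rewrite !in_itv/= => /andP[->].
  - by rewrite gtrBl.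
  - exact: cG.
  by apply: DeriveDef; [exact: dI|rewrite -derive1E; exact: eI].
have E : \forall z \near y, tail G (y - 1) - I z = tail G z.
  near=> z.
  rewrite /tail /I (@Rintegral_itvB _ G (BLeft (y - 1)) +oo%O z)//.
  - by rewrite Rintegral_itv_obnd_cbnd//; apply: integrableS (iG z) => // s /=;
      rewrite !in_itv/= !andbT => /ltW.
  - rewrite bnd_simp; apply: ltW; near: z.
    by apply: (cvgr_gt y cvg_id); rewrite gtrBl.
apply: (near_eq_is_derive E).
apply: is_derive_eq (is_deriveB (is_derive_cst (tail G (y - 1)) y 1) D) _.
by rewrite sub0r.
Unshelve. all: by end_near. Qed.

End TailIntegral.

(** * Mean value arguments on the half-line *)

Section HalfLineCalculus.
Context {R : realType}.
Implicit Types x y : R.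

Lemma derive0_cst_halfline (f : R -> R) : (forall x : R, 0 < x -> is_derive x 1 f 0) ->
  forall x y, 0 < x -> 0 < y -> f x = f y.
Proof.
move=> df.
have H x y : 0 < x -> x <= y -> f x = f y.
  move=> x0 xy.
  have [||z _] := @MVT_segment _ f (cst 0) x y xy.
  - by move=> z; rewrite in_itv/= => /andP[xz _]; apply: df; exact: lt_trans xz.
  - apply: derivable_within_continuous => z; rewrite in_itv/= => /andP[xz _].
    by have [] := df z (lt_le_trans x0 xz).
  by rewrite mul0r => /eqP; rewrite subr_eq0 => /eqP.
move=> x y x0 y0; have [xy|/ltW yx] := leP x y; first exact: H.
exact/esym/H.
Qed.

Lemma lipschitz_halfline (f df : R -> R) (K : R) :
  (forall x : R, is_derive x 1 f (df x)) -> (forall x, 0 <= x -> `|df x| <= K) ->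
  forall x y, 0 <= x -> 0 <= y -> `|f x - f y| <= K * `|x - y|.
Proof.
move=> Df dfK.
have H x y : 0 <= x -> x <= y -> `|f x - f y| <= K * `|x - y|.
  move=> x0 xy; have [|z] := @MVT_segment _ f df x y xy.
    by apply: derivable_within_continuous => z _; have [] := Df z.
  rewrite in_itv/= => /andP[xz _] e; rewrite distrC e normrM [`|x - y|]distrC.
  by rewrite ler_wpM2r// dfK// (le_trans x0).
move=> x y x0 y0; have [xy|/ltW yx] := leP x y; first exact: H.
by rewrite distrC [`|x - y|]distrC; exact: H.
Qed.

End HalfLineCalculus.

(** * Green operator for u'' - c u' = F with bounded derivative *)

Section ResolventODE.
Context {R : realType} (c : R) (c0 : 0 < c).
Implicit Types (F u du : R -> R) (B M y : R).

Let P F := tail (fun s => expR (- c * s) * F s).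

(* [green F y] is the integral of [F s * (1 - expR (- c * (s - y))) / c] over [s >= y]. *)
Definition green F y : R := (tail F y - expR (c * y) * P F y) / c.
Definition dgreen F y : R := - (expR (c * y) * P F y).

Let half : (0 : R) < 2^-1. Proof. by rewrite invr_gt0. Qed.
Let chalf : 0 < c + 2^-1. Proof. by rewrite addr_gt0. Qed.

Let continuous_weight F : continuous F -> continuous (fun s => expR (- c * s) * F s).
Proof. by move=> cF s; apply: cvgM; [exact: continuous_expRZ|exact: cF]. Qed.

Let exp_bounded_weight B F : exp_bounded B 2^-1 F ->
  exp_bounded B (c + 2^-1) (fun s => expR (- c * s) * F s).
Proof.
move=> FB s; rewrite normrM (ger0_norm (expR_ge0 _)).
rewrite opprD mulrDl expRD mulrCA ler_wpM2l ?expR_ge0//; exact: FB.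
Qed.

Lemma is_derive_green B F y : continuous F -> exp_bounded B 2^-1 F ->
  is_derive y 1 (green F) (dgreen F y).
Proof.
move=> cF FB.
have D1 := is_derive_tail y half cF FB.
have D2 := is_derive_tail y chalf (continuous_weight cF) (exp_bounded_weight FB).
have D3 := is_deriveZ c^-1 (is_deriveB D1 (is_deriveM (is_derive_expRZ c y) D2)).
have -> : green F = c^-1 \*: (tail F - (fun t => expR (c * t)) * P F).
  by apply/funext => z; rewrite /green /= /GRing.scale/= mulrC.
apply: is_derive_eq D3 _; rewrite /dgreen /GRing.scale/=.
have -> : - c * y = - (c * y) by ring.
rewrite expRN -/(P F y); field; by rewrite !gt_eqF// expR_gt0.
Qed.

Lemma is_derive_dgreen B F y : continuous F -> exp_bounded B 2^-1 F ->
  is_derive y 1 (dgreen F) (c * dgreen F y + F y).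
Proof.
move=> cF FB.
have D2 := is_derive_tail y chalf (continuous_weight cF) (exp_bounded_weight FB).
have D3 := is_deriveN (is_deriveM (is_derive_expRZ c y) D2).
apply: is_derive_eq D3 _; rewrite /dgreen /GRing.scale/=.
have -> : - c * y = - (c * y) by ring.
rewrite expRN -/(P F y); field; by rewrite gt_eqF// expR_gt0.
Qed.

(** The growth e^{cy} cancels against the weight e^{-cs} inside the tail, and 1 / (c + 1/2) <= 2
    makes the bound uniform in [c]. *)
Lemma dgreen_bound B F y : continuous F -> exp_bounded B 2^-1 F ->
  `|dgreen F y| <= 2 * B * expR (- 2^-1 * y).
Proof.
move=> cF FB.
have B0 : 0 <= B by have := le_trans (normr_ge0 _) (FB 0); rewrite mulr0 expR0 mulr1.
have H := tail_bound y chalf (continuous_weight cF) (exp_bounded_weight FB).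
rewrite /dgreen normrN normrM (ger0_norm (expR_ge0 _)).
apply: le_trans (ler_wpM2l (expR_ge0 _) H) _.
rewrite mulrCA -expRD (_ : c * y + _ = - 2^-1 * y); last by ring.
rewrite ler_wpM2r ?expR_ge0// ler_pdivrMr//.
rewrite (_ : 2 * B * (c + 2^-1) = B + 2 * (B * c)); last by field.
by rewrite lerDl mulr_ge0// mulr_ge0// ltW.
Qed.

(** Both terms of [green] are at most 2 B e^{-y/2} before the division by [c]; this division is how
    [c] enters the smallness condition on [eps]. *)
Lemma green_bound B F y : continuous F -> exp_bounded B 2^-1 F ->
  `|green F y| <= 4 / c * B * expR (- 2^-1 * y).
Proof.
move=> cF FB.
have H1 := tail_bound y half cF FB; have H2 := dgreen_bound y cF FB.
rewrite /green normrM (ger0_norm (x := c^-1)) ?invr_ge0 ?(ltW c0)//.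
rewrite (_ : 4 / c * B * _ = (4 * B * expR (- 2^-1 * y)) * c^-1); last by ring.
rewrite ler_wpM2r ?invr_ge0 ?(ltW c0)//.
apply: le_trans (ler_normD _ _) _; rewrite -/(dgreen F y).
by move: H1; rewrite invrK; lra.
Qed.

Lemma greenB B F1 F2 y : continuous F1 -> continuous F2 ->
  exp_bounded B 2^-1 F1 -> exp_bounded B 2^-1 F2 ->
  green (fun s => F1 s - F2 s) y = green F1 y - green F2 y.
Proof.
move=> c1 c2 b1 b2; rewrite /green (tailB y half c1 c2 b1 b2) /P.
have -> : tail (fun s => expR (- c * s) * (F1 s - F2 s)) y =
    tail (fun s => expR (- c * s) * F1 s - expR (- c * s) * F2 s) y.
  by apply: eq_Rintegral => s _; rewrite mulrBr.
rewrite (@tailB _ _ _ B (c + 2^-1))//; last 4 first.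
- exact: continuous_weight.
- exact: continuous_weight.
- exact: exp_bounded_weight.
- exact: exp_bounded_weight.
ring.
Qed.

Lemma bounded_solution_green B M F u du l : continuous F -> exp_bounded B 2^-1 F ->
  (forall y, 0 < y -> is_derive y 1 u (du y)) ->
  (forall y, 0 < y -> is_derive y 1 du (c * du y + F y)) ->
  (forall y, 0 < y -> `|du y| <= M) -> u x @[x --> +oo] --> l ->
  forall y, 0 < y -> u y = l + green F y.
Proof.
move=> cF FB Du Ddu duM ul.
(* With this integrating factor the difference of the derivatives becomes constant; as both
   derivatives are bounded, the constant is 0. *)
pose v y := expR (- c * y) * (du y - dgreen F y).
have Dv y : 0 < y -> is_derive y 1 v 0.
  move=> y0.
  have D := is_deriveM (is_derive_expRZ (- c) y)
    (is_deriveB (Ddu y y0) (is_derive_dgreen y cF FB)).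
  by apply: is_derive_eq D _; rewrite /GRing.scale/= !fctE; ring.
have decay : expR (- c * x) * (M + 2 * B) @[x --> +oo] --> (0 : R).
  rewrite -[X in _ --> X](mul0r (M + 2 * B)).
  by apply: cvgM; [exact: cvg_expRZ_pinfty|exact: cvg_cst].
have B0 : 0 <= B by have := le_trans (normr_ge0 _) (FB 0); rewrite mulr0 expR0 mulr1.
have du_green y : 0 < y -> du y = dgreen F y.
  move=> y0; apply/eqP; rewrite -subr_eq0 -normr_le0.
  have vle : `|v y| <= 0.
    apply: (ler_cvg_to (cvg_cst _) decay).
    near=> x; have x0 : 0 < x by near: x; exact: nbhs_pinfty_gt.
    rewrite (derive0_cst_halfline Dv y0 x0) /v normrM (ger0_norm (expR_ge0 _)).
    rewrite ler_wpM2l ?expR_ge0//.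
    apply: le_trans (ler_normB _ _) _; apply: lerD; first exact: duM.
    apply: le_trans (dgreen_bound x cF FB) _.
    by rewrite ler_piMr ?mulr_ge0// expR_le1; lra.
  move: vle; rewrite /v normrM (ger0_norm (expR_ge0 _)).
  by rewrite pmulr_rle0 ?expR_gt0.
(* With equal derivatives [u - green F] is constant, and its value is read off at infinity, where
   [green F] vanishes. *)
have Dw y : 0 < y -> is_derive y 1 (u - green F) 0.
  move=> y0; apply: is_derive_eq (is_deriveB (Du y y0) (is_derive_green y cF FB)) _.
  by rewrite du_green// subrr.
have green0 : green F x @[x --> +oo] --> (0 : R).
  have K0 : 4 / c * B * expR (- 2^-1 * x) @[x --> +oo] --> (0 : R).
    rewrite -[X in _ --> X](mulr0 (4 / c * B)).
    by apply: cvgM; [exact: cvg_cst|exact: cvg_expRZ_pinfty].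
  have K1 : - (4 / c * B * expR (- 2^-1 * x)) @[x --> +oo] --> (0 : R).
    by rewrite -[X in _ --> X]oppr0; exact: cvgN K0.
  apply: (squeeze_cvgr _ K1 K0).
  by near=> x; rewrite -ler_norml; exact: green_bound.
move=> y y0; apply/eqP; rewrite -subr_eq; apply/eqP.
have lim : (u x - green F x) @[x --> +oo] --> l.
  by rewrite -[X in _ --> X](subr0 l); apply: cvgB.
have lim' : (u x - green F x) @[x --> +oo] --> u y - green F y.
  apply: cvg_near_cst; near=> x.
  have x0 : 0 < x by near: x; exact: nbhs_pinfty_gt.
  exact: (derive0_cst_halfline Dw x0 y0).
exact: (cvg_unique _ lim' lim).
Unshelve. all: by end_near. Qed.

End ResolventODE.

(** * Fixed points of maps that halve a weighted sup distance *)

Section WeightedContraction.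
Context {R : realType} (w : R -> R) (A : R).
Hypotheses (w0 : forall y, 0 <= w y) (A0 : 0 <= A).

Lemma le_geometric_half_le0 (x K : R) : (forall n, x <= K * 2^-1 ^+ n) -> x <= 0.
Proof.
move=> H; have h1 : `|2^-1 : R| < 1 by rewrite ger0_norm// invf_lt1// ltr1n.
apply: (ler_cvg_to (cvg_cst x) (cvg_geometric K h1)).
by near=> n; exact: H.
Unshelve. all: by end_near. Qed.

(** Contraction of ratio 1/2 for the distance sup |g1 - g2| / w, expressed through arbitrary bounds
    [D] instead of a norm. *)
Definition halving (X : set (R -> R)) (T : (R -> R) -> R -> R) :=
  forall g1 g2 D, X g1 -> X g2 -> 0 <= D -> (forall y, `|g1 y - g2 y| <= D * w y) ->
  forall y, `|T g1 y - T g2 y| <= D / 2 * w y.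

Lemma halving_fixpoint_unique X T g1 g2 : halving X T -> X g1 -> X g2 ->
  (forall y, `|g1 y| <= A * w y) -> (forall y, `|g2 y| <= A * w y) ->
  T g1 =1 g1 -> T g2 =1 g2 -> g1 =1 g2.
Proof.
move=> HT X1 X2 b1 b2 f1 f2 y; apply/eqP; rewrite -subr_eq0 -normr_le0.
apply: (@le_geometric_half_le0 _ (2 * A * w y)) => n.
rewrite mulrAC; elim: n y => [|n IH] y.
  rewrite expr0 mulr1; apply: le_trans (ler_normB _ _) _.
  by have := b1 y; have := b2 y; lra.
rewrite -f1 -f2 exprS.
have := HT _ _ (2 * A * 2^-1 ^+ n) X1 X2 _ IH y.
rewrite (_ : _ / 2 * w y = 2 * A * (2^-1 * 2^-1 ^+ n) * w y); last by ring.
by apply; rewrite !mulr_ge0// exprn_ge0.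
Qed.

(** Picard iteration from [g0]; the closedness of [X] under pointwise limits takes the place of
    completeness. *)
Lemma halving_fixpoint (X : set (R -> R)) T g0 : halving X T -> X g0 ->
  (forall g, X g -> X (T g)) -> (forall g, X g -> forall y, `|g y| <= A * w y) ->
  (forall (u : nat -> R -> R) g, (forall n, X (u n)) ->
    (forall y, u n y @[n --> \oo] --> g y) -> X g) ->
  exists2 g, X g & T g =1 g.
Proof.
move=> HT Xg0 XT XA Xlim; pose u n := iter n T g0.
have Xu n : X (u n) by elim: n => //= n; exact: XT.
have step n y : `|u n.+1 y - u n y| <= 2 * A * 2^-1 ^+ n * w y.
  elim: n y => [|n IH] y.
    rewrite expr0 mulr1; apply: le_trans (ler_normB _ _) _.
    by have := XA _ (Xu 1%N) y; have := XA _ (Xu 0%N) y; lra.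
  rewrite exprS.
  have := HT _ _ (2 * A * 2^-1 ^+ n) (Xu n.+1) (Xu n) _ IH y.
  rewrite (_ : _ / 2 * w y = 2 * A * (2^-1 * 2^-1 ^+ n) * w y); last by ring.
  by apply; rewrite !mulr_ge0// exprn_ge0.
(* The right-hand side is the exact geometric sum of the increment bounds of indices [n] to
   [n + m - 1], so the induction on [m] closes. *)
have dist n m y : `|u (n + m)%N y - u n y| <= 4 * A * (2^-1 ^+ n - 2^-1 ^+ (n + m)) * w y.
  elim: m => [|m IH]; first by rewrite addn0 !subrr normr0 mulr0 mul0r.
  rewrite addnS -(subrKA (u (n + m)%N y)); apply: le_trans (ler_normD _ _) _.
  have := step (n + m)%N y; move: IH; rewrite exprS.
  set p := _ ^+ (n + m); set q := _ ^+ n => IH S.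
  rewrite (_ : 4 * A * (q - 2^-1 * p) * w y =
    2 * A * p * w y + 4 * A * (q - p) * w y); last by field.
  exact: lerD.
have cu y : cvgn (fun n => u n y).
  have h1 : `|2^-1 : R| < 1 by rewrite ger0_norm// invf_lt1// ltr1n.
  have S : cvgn (series (fun n => u n.+1 y - u n y)).
    apply: normed_cvg; apply: (series_le_cvg _ _ _
      (is_cvg_geometric_series (a := 2 * A * w y) h1)) => n //=.
      by rewrite !mulr_ge0// exprn_ge0.
    by rewrite mulrAC; exact: step.
  have -> : (fun n => u n y) = (fun n => u 0%N y + series (fun n => u n.+1 y - u n y) n).
    by apply/funext => n; rewrite /series /= telescope_sumr// addrC subrK.
  by apply: is_cvgD; [exact: is_cvg_cst|exact: S].
pose g y := limn (fun n => u n y).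
have ug y : u n y @[n --> \oo] --> g y by exact: cu.
have Xg : X g by exact: Xlim ug.
have gu n y : `|g y - u n y| <= 4 * A * 2^-1 ^+ n * w y.
  have C : `|u m y - u n y| @[m --> \oo] --> `|g y - u n y|.
    by apply: cvg_norm; apply: cvgB; [exact: ug|exact: cvg_cst].
  apply: (ler_cvg_to C (cvg_cst _)); near=> m.
  have nm : (n <= m)%N by near: m; exact: nbhs_infty_ge.
  rewrite -(subnKC nm); apply: le_trans (dist _ _ _) _.
  by rewrite ler_wpM2r// ler_wpM2l ?mulr_ge0// gerBl exprn_ge0.
exists g => // y; apply/eqP; rewrite -subr_eq0 -normr_le0.
apply: (@le_geometric_half_le0 _ (4 * A * w y)) => n.
(* Comparison through [u n.+1 = T (u n)]: each of the two distances is at most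
   [2 * A * 2^-1 ^+ n * w y]. *)
rewrite -(subrKA (u n.+1 y)); apply: le_trans (ler_normD _ _) _.
have H1 := HT _ _ (4 * A * 2^-1 ^+ n) Xg (Xu n) _ (gu n) y.
have H2 := gu n.+1 y; rewrite distrC exprS in H2.
apply: le_trans (lerD (H1 _) H2) _; first by rewrite !mulr_ge0// exprn_ge0.
by set p := _ ^+ n; rewrite le_eqVlt; apply/orP; left; apply/eqP; field.
Unshelve. all: by end_near. Qed.

End WeightedContraction.

(** * The fixed point map *)

Section Moduli.
Context {R : realType}.
Implicit Types (f m : R -> R) (K N d : R).

Lemma continuous_modulus f m : {for 0, continuous m} -> m 0 = 0 ->
  (forall x y, `|f x - f y| <= m `|x - y|) -> continuous f.
Proof.
move=> cm m0 fm x; apply/cvgrPdist_lt => e e0.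
have C0 : `|x - y| @[y --> x] --> (0 : R).
  have : `|x - y| @[y --> x] --> `|x - x|.
    by apply: cvg_norm; apply: cvgB; [exact: cvg_cst|exact: cvg_id].
  by rewrite subrr normr0.
have C : m `|x - y| @[y --> x] --> (0 : R).
  by have := cvg_comp _ _ C0 cm; rewrite m0.
near=> y; apply: le_lt_trans (fm _ _) _; near: y.
by apply: (cvgr_lt (0 : R) C).
Unshelve. all: by end_near. Qed.

Lemma continuous_lipschitz f K : (forall x y, `|f x - f y| <= K * `|x - y|) -> continuous f.
Proof.
apply: (@continuous_modulus _ (fun d => K * d)); last by rewrite mulr0.
by apply: cvgM; [exact: cvg_cst|exact: cvg_id].
Qed.

Lemma continuous_holder f K : (forall x y, `|f x - f y| <= K * Num.sqrt `|x - y|) -> continuous f.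
Proof.
apply: (@continuous_modulus _ (fun d => K * Num.sqrt d)); last by rewrite sqrtr0 mulr0.
by apply: cvgM; [exact: cvg_cst|exact: sqrt_continuous].
Qed.

(** For d <= 1 the Lipschitz bound suffices because d <= sqrt d; for d >= 1 the uniform bound does
    because 1 <= sqrt d. *)
Lemma lipschitz_bounded_holder K N d (z : R) : 0 <= K -> 0 <= N -> 0 <= d ->
  z <= K * d -> z <= N -> z <= (K + N) * Num.sqrt d.
Proof.
move=> K0 N0 d0 zK zN; have s0 := sqrtr_ge0 d.
have [d1|/ltW d1] := leP d 1.
  have sd : d <= Num.sqrt d.
    rewrite -{1}(sqr_sqrtr d0) expr2 ler_piMr//.
    by rewrite -sqrtr1 ler_sqrt.
  apply: le_trans zK _; apply: le_trans (ler_wpM2l K0 sd) _.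
  by rewrite ler_wpM2r// lerDl.
have sd : 1 <= Num.sqrt d by rewrite -{1}sqrtr1 ler_sqrt.
apply: le_trans zN _; apply: le_trans (ler_peMr N0 sd) _.
by rewrite ler_wpM2r// lerDr.
Qed.

Lemma dist_prod_le (b d1 d2 B x1 x2 y1 y2 : R) : `|x1| <= b -> `|y2| <= B ->
  `|x1 - x2| <= d1 -> `|y1 - y2| <= d2 -> `|x1 * y1 - x2 * y2| <= b * d2 + d1 * B.
Proof.
move=> bx by_ dx dy.
rewrite (_ : _ - _ = x1 * (y1 - y2) + (x1 - x2) * y2); last by ring.
by apply: le_trans (ler_normD _ _) _; rewrite !normrM; apply: lerD; apply: ler_pM.
Qed.

End Moduli.

(* Opaque, so that unification never unfolds the numeral. *)
Lemma source_const_subproof (R : realType) : {K : R | K = 456}.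
Proof. by exists 456. Qed.

Definition source_const (R : realType) : R := sval (source_const_subproof R).

Lemma source_constE (R : realType) : source_const R = 456.
Proof. exact: (svalP (source_const_subproof R)). Qed.

Lemma source_const_ge0 (R : realType) : 0 <= source_const R.
Proof. by rewrite source_constE ler0n. Qed.

Section FixedPointMap.
Context {R : realType} (c eps : R).
Hypotheses (c0 : 0 < c) (eps0 : 0 < eps) (small : 8 * source_const R * eps ^+ 3 <= c).
Notation mu := (@lebesgue_measure R).
Implicit Types (g : R -> R) (y D : R).

Definition weight y : R := expR (- 2^-1 * `|y|).
(* [g] stands for [f - f_oo]; the boundary condition [f 0 = eps] forces [f_oo = eps - g 0]. *)
Definition profile g y : R := eps - g 0 + g y.
Definition emission g y : R := profile g y ^+ 4.
(* Evaluated at [|y|] so that all functions are globally defined, continuous and even. *)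
Definition source g y : R := emission g `|y| - halfconv (emission g) `|y|.
Definition fixmap g y : R := green c (source g) `|y|.

(** The radius keeps [profile g] between [eps / 2] and [2 * eps], which yields positivity and all
    bounds on fourth powers. *)
Definition admissible g := continuous g /\ forall y, `|g y| <= eps / 4 * weight y.

Lemma weight_ge0 y : 0 <= weight y. Proof. exact: expR_ge0. Qed.

Lemma weight_le1 y : weight y <= 1.
Proof. by rewrite expR_le1 mulNr oppr_le0 mulr_ge0// invr_ge0. Qed.

Lemma weight_norm y : weight `|y| = weight y.
Proof. by rewrite /weight normr_id. Qed.

Lemma admissible_le g y : admissible g -> `|g y| <= eps / 4.
Proof.
case=> _ /(_ y) H; apply: le_trans H _.
by rewrite ler_piMr ?weight_le1// divr_ge0// ltW.
Qed.

Lemma profile_bounds g y : admissible g -> eps / 2 <= profile g y <= 2 * eps.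
Proof.
move=> ag; have := admissible_le y ag; have := admissible_le 0 ag.
rewrite !ler_norml /profile => /andP[h1 h2] /andP[h3 h4].
by apply/andP; split; lra.
Qed.

Lemma norm_profile g y : admissible g -> `|profile g y| <= 2 * eps.
Proof.
move=> ag; have /andP[h1 h2] := profile_bounds y ag.
by rewrite ger0_norm//; lra.
Qed.

Lemma norm_emission g y : admissible g -> `|emission g y| <= 16 * eps ^+ 4.
Proof.
move=> ag; rewrite /emission normrX.
apply: le_trans (lerXn2r 4 _ _ (norm_profile y ag)) _; rewrite ?nnegrE ?mulr_ge0 ?(ltW eps0)//.
by rewrite exprMn -natrX.
Qed.

Lemma continuous_profile g : admissible g -> continuous (profile g).
Proof.
by move=> [cg _] y; apply: cvgD; [exact: cvg_cst|exact: cg].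
Qed.

Lemma continuous_emission g : admissible g -> continuous (emission g).
Proof.
move=> ag y; apply: (@continuous_comp _ _ _ (profile g) (fun x => x ^+ 4)).
- exact: continuous_profile.
- exact: exprn_continuous.
Qed.

Lemma measurable_emission g : admissible g -> measurable_fun setT (emission g).
Proof. by move=> ag; apply: continuous_measurable_fun; exact: continuous_emission. Qed.

Lemma continuous_comp_norm (f : R -> R) : continuous f -> continuous (fun y : R => f `|y|).
Proof.
move=> cf y; apply: (@continuous_comp _ _ _ (fun y : R => `|y|) f); last exact: cf.
exact: norm_continuous.
Qed.

Lemma halfconv_emission_holder g x y : admissible g ->
  `|halfconv (emission g) x - halfconv (emission g) y| <=
  48 * eps ^+ 4 * Num.sqrt `|x - y|.
Proof.
move=> ag; rewrite (_ : 48 * eps ^+ 4 = 3 * (16 * eps ^+ 4)); last by ring.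
by apply: halfconv_holder; [exact: measurable_emission|move=> eta _; exact: norm_emission].
Qed.

Lemma continuous_source g : admissible g -> continuous (source g).
Proof.
move=> ag y; apply: cvgB.
  by apply: (continuous_comp_norm (continuous_emission ag)).
apply: (continuous_comp_norm (f := halfconv (emission g))).
by apply: (@continuous_holder _ _ (48 * eps ^+ 4)) => ? ?; exact: halfconv_emission_holder.
Qed.

Lemma halfconv_cst (a y : R) : halfconv (cst a) y = a * halfconv (cst 1) y.
Proof.
rewrite /halfconv -RintegralZl//; last first.
  apply: (@integrable_rkernelM _ y (cst 1) 1) => // eta _.
  by rewrite normr1.
by apply: eq_Rintegral => eta _ /=; rewrite mulr1 mulrC.
Qed.

(** The cofactor in [a ^+ 4 - b ^+ 4 = (a - b) * cubesum a b]. *)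
Definition cubesum (a b : R) := a ^+ 3 + a ^+ 2 * b + a * b ^+ 2 + b ^+ 3.

Lemma dist_cubesum (b d x1 x2 y1 y2 : R) : `|x1| <= b -> `|x2| <= b -> `|y1| <= b ->
  `|y2| <= b -> `|x1 - x2| <= d -> `|y1 - y2| <= d ->
  `|cubesum x1 y1 - cubesum x2 y2| <= 12 * b ^+ 2 * d.
Proof.
move=> hx1 hx2 hy1 hy2 dx dy; have b0 : 0 <= b := le_trans (normr_ge0 _) hx1.
have prod3 (a1 a2 b1 b2 e1 e2 : R) : `|a1| <= b -> `|b2| <= b -> `|e2| <= b ->
    `|b1| <= b -> `|a1 - a2| <= d -> `|b1 - b2| <= d -> `|e1 - e2| <= d ->
    `|a1 * (b1 * e1) - a2 * (b2 * e2)| <= 3 * b ^+ 2 * d.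
  move=> h1 h2 h3 h4 k1 k2 k3.
  have H := dist_prod_le h4 h3 k2 k3.
  have H2 : `|b2 * e2| <= b ^+ 2 by rewrite normrM expr2; exact: ler_pM.
  apply: le_trans (dist_prod_le h1 H2 k1 H) _.
  by rewrite le_eqVlt; apply/orP; left; apply/eqP; ring.
have -> : cubesum x1 y1 - cubesum x2 y2 =
    (x1 * (x1 * x1) - x2 * (x2 * x2)) + (x1 * (x1 * y1) - x2 * (x2 * y2)) +
    (x1 * (y1 * y1) - x2 * (y2 * y2)) + (y1 * (y1 * y1) - y2 * (y2 * y2)).
  by rewrite /cubesum; ring.
have -> : 12 * b ^+ 2 * d = 3 * b ^+ 2 * d + 3 * b ^+ 2 * d + 3 * b ^+ 2 * d + 3 * b ^+ 2 * d.
  by ring.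
by do 3?[apply: le_trans (ler_normD _ _) _; apply: lerD]; apply: prod3.
Qed.

Lemma norm_cubesum (b x y : R) : `|x| <= b -> `|y| <= b -> `|cubesum x y| <= 4 * b ^+ 3.
Proof.
move=> hx hy; have b0 : 0 <= b := le_trans (normr_ge0 _) hx.
have prod3 (p q r : R) : `|p| <= b -> `|q| <= b -> `|r| <= b -> `|p * (q * r)| <= b ^+ 3.
  move=> h1 h2 h3; rewrite !normrM exprS expr2.
  by apply: ler_pM => //; apply: ler_pM.
have -> : cubesum x y = x * (x * x) + x * (x * y) + x * (y * y) + y * (y * y).
  by rewrite /cubesum; ring.
have -> : 4 * b ^+ 3 = b ^+ 3 + b ^+ 3 + b ^+ 3 + b ^+ 3 by ring.
by do 3?[apply: le_trans (ler_normD _ _) _; apply: lerD]; apply: prod3.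
Qed.

(** With [s1], [s2] the two limits, the difference of the emissions is the constant
    [s1 ^+ 4 - s2 ^+ 4] plus a remainder [kappa]. The constant is multiplied by the lost mass, which
    decays; [kappa] decays by itself, and so does its convolution. *)
Lemma source_diff_sharp g1 g2 D y : admissible g1 -> admissible g2 -> 0 <= D ->
  (forall x, `|g1 x - g2 x| <= D * weight x) ->
  `|source g1 y - source g2 y| <= 448 * eps ^+ 3 * D * weight y.
Proof.
move=> a1 a2 D0 gD; set b := 2 * eps.
have e0 := ltW eps0.
have gD1 x : `|g1 x - g2 x| <= D.
  by apply: le_trans (gD x) _; rewrite ler_piMr// weight_le1.
pose s1 := eps - g1 0; pose s2 := eps - g2 0.
have hs i g : admissible g -> i = eps - g 0 -> `|i| <= b.
  move=> ag ->; have := admissible_le 0 ag; rewrite !ler_norml /b => /andP[h1 h2].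
  by apply/andP; split; lra.
have hs1 : `|s1| <= b by exact: (hs _ _ a1).
have hs2 : `|s2| <= b by exact: (hs _ _ a2).
have hp1 x : `|profile g1 x| <= b by exact: norm_profile.
have hp2 x : `|profile g2 x| <= b by exact: norm_profile.
have ds : `|s1 - s2| <= D.
  by rewrite (_ : s1 - s2 = - (g1 0 - g2 0)) ?normrN// /s1 /s2; ring.
have dp x : `|profile g1 x - profile g2 x| <= 2 * D.
  rewrite (_ : _ - _ = (s1 - s2) + (g1 x - g2 x)); last by rewrite /profile /s1 /s2; ring.
  by apply: le_trans (ler_normD _ _) _; have := gD1 x; lra.
have fourth (u v : R) : u ^+ 4 - v ^+ 4 = (u - v) * cubesum u v by rewrite /cubesum; ring.
pose kappa eta := (emission g1 eta - emission g2 eta) - (s1 ^+ 4 - s2 ^+ 4).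
(* As [profile g1 - s1 = g1] and likewise for [g2], [kappa] is a difference of products of [g] with
   a [cubesum], and the weight comes from [g1] or from [g1 - g2]. The product rule gives 24 + 32 =
   56, rounded up to 128. *)
have hkappa eta : `|kappa eta| <= 128 * eps ^+ 3 * D * weight eta.
  have -> : kappa eta = g1 eta * cubesum (profile g1 eta) s1 -
      g2 eta * cubesum (profile g2 eta) s2.
    rewrite /kappa /emission.
    rewrite (_ : g1 eta = profile g1 eta - s1); last by rewrite /profile /s1; ring.
    rewrite (_ : g2 eta = profile g2 eta - s2); last by rewrite /profile /s2; ring.
    by rewrite -!fourth; ring.
  have ds' : `|s1 - s2| <= 2 * D by apply: le_trans ds _; lra.
  have H1 := dist_cubesum (hp1 eta) (hp2 eta) hs1 hs2 (dp eta) ds'.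
  have H2 := norm_cubesum (hp2 eta) hs2.
  apply: le_trans (dist_prod_le (a1.2 eta) H2 (gD eta) H1) _.
  rewrite /b (_ : _ + _ = 56 * eps ^+ 3 * D * weight eta); last by field.
  rewrite ler_wpM2r ?weight_ge0// ler_wpM2r// ler_wpM2r ?exprn_ge0// ler_nat//.
have mk : measurable_fun setT kappa.
  apply: measurable_funB => //; apply: measurable_funB; exact: measurable_emission.
have Hconv : halfconv kappa `|y| = halfconv (emission g1) `|y| -
    halfconv (emission g2) `|y| - (s1 ^+ 4 - s2 ^+ 4) * halfconv (cst 1) `|y|.
  rewrite -(halfconv_cst (s1 ^+ 4 - s2 ^+ 4)).
  rewrite -(@halfconvB _ _ _ _ (16 * eps ^+ 4)); last 4 first.
  - exact: measurable_emission.
  - exact: measurable_emission.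
  - by move=> eta _; exact: norm_emission.
  - by move=> eta _; exact: norm_emission.
  rewrite -(@halfconvB _ _ _ _ (32 * eps ^+ 4 + `|s1 ^+ 4 - s2 ^+ 4|))//.
  - by apply: measurable_funB; exact: measurable_emission.
  - move=> eta _; apply: le_trans (ler_normB _ _) _.
    have := norm_emission eta a1; have := norm_emission eta a2.
    by have := normr_ge0 (s1 ^+ 4 - s2 ^+ 4); lra.
  - by move=> eta _ /=; rewrite lerDr mulr_ge0// exprn_ge0.
have -> : source g1 y - source g2 y =
    (s1 ^+ 4 - s2 ^+ 4) * (1 - halfconv (cst 1) `|y|) + (kappa `|y| - halfconv kappa `|y|).
  by rewrite Hconv /source /kappa; ring.
apply: le_trans (ler_normD _ _) _.
have T1 : `|(s1 ^+ 4 - s2 ^+ 4) * (1 - halfconv (cst 1) `|y|)| <=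
    D * (4 * b ^+ 3) * (2 * weight y).
  rewrite normrM; apply: ler_pM => //.
    by rewrite fourth normrM; apply: ler_pM => //; exact: norm_cubesum.
  exact: halfconv1_defect.
have T2 : `|kappa `|y| - halfconv kappa `|y| | <=
    128 * eps ^+ 3 * D * weight y + 2 * (128 * eps ^+ 3 * D) * weight y.
  apply: le_trans (ler_normB _ _) _; apply: lerD.
    by rewrite -(weight_norm y).
  apply: halfconv_weighted => // eta eta0.
  by apply: le_trans (hkappa eta) _; rewrite /weight (ger0_norm eta0).
(* In units of [eps ^+ 3 * D]: 64 from the lost mass, 128 from [kappa] and 256 from its convolution,
   in all 448. *)
apply: le_trans (lerD T1 T2) _.
by rewrite /b le_eqVlt; apply/orP; left; apply/eqP; ring.
Qed.

Lemma source_diff g1 g2 D y : admissible g1 -> admissible g2 -> 0 <= D ->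
  (forall x, `|g1 x - g2 x| <= D * weight x) ->
  `|source g1 y - source g2 y| <= source_const R * eps ^+ 3 * D * weight y.
Proof.
move=> a1 a2 D0 gD; apply: le_trans (source_diff_sharp y a1 a2 D0 gD) _.
rewrite ler_wpM2r ?weight_ge0// ler_wpM2r// ler_wpM2r ?exprn_ge0 ?(ltW eps0)//.
by rewrite source_constE ler_nat.
Qed.

Lemma admissible0 : admissible (cst 0).
Proof.
split=> [y|y]; first exact: cvg_cst.
by rewrite normr0 mulr_ge0 ?weight_ge0// divr_ge0// ltW.
Qed.

(** Comparison with [g = 0], whose emission is constant, so that its source is [eps ^+ 4] times the
    lost mass, at most [2 * eps ^+ 4]. The difference costs 448 / 4 = 112, and 112 + 2 = 456 / 4
    explains the value of [source_const]. *)
Lemma source_bound g y : admissible g -> `|source g y| <= source_const R / 4 * eps ^+ 4 * weight y.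
Proof.
move=> ag; have e0 := ltW eps0.
have H0 : `|source (cst 0) y| <= 2 * eps ^+ 4 * weight y.
  have E : emission (cst 0) = cst (eps ^+ 4).
    by apply/funext => x; rewrite /emission /profile /= subr0 addr0.
  rewrite /source E halfconv_cst /=.
  rewrite (_ : _ - _ = eps ^+ 4 * (1 - halfconv (cst 1) `|y|)); last by ring.
  rewrite normrM ger0_norm ?exprn_ge0//.
  rewrite (_ : 2 * eps ^+ 4 * weight y = eps ^+ 4 * (2 * weight y)); last by ring.
  rewrite ler_wpM2l ?exprn_ge0//.
  exact: halfconv1_defect.
have H1 : `|source g y - source (cst 0) y| <= 448 * eps ^+ 3 * (eps / 4) * weight y.
  apply: source_diff_sharp => //; [exact: admissible0|by rewrite divr_ge0|].
  by move=> x; rewrite subr0; exact: ag.2.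
rewrite -(subrK (source (cst 0) y) (source g y)).
apply: le_trans (ler_normD _ _) _; apply: le_trans (lerD H1 H0) _.
by rewrite source_constE le_eqVlt; apply/orP; left; apply/eqP; field.
Qed.

Lemma weight_le_expR y : weight y <= expR (- 2^-1 * y).
Proof. by rewrite ler_expR; have := ler_norm y; lra. Qed.

Lemma exp_bounded_source g : admissible g -> exp_bounded (source_const R / 4 * eps ^+ 4) 2^-1 (source g).
Proof.
move=> ag s; apply: le_trans (source_bound s ag) _.
by rewrite ler_wpM2l ?weight_le_expR// mulr_ge0 ?divr_ge0 ?source_const_ge0// exprn_ge0// ltW.
Qed.

Lemma fixmap_bound g y : admissible g -> `|fixmap g y| <= eps / 4 * weight y.
Proof.
move=> ag.
apply: le_trans (green_bound c0 `|y| (continuous_source ag) (exp_bounded_source ag)) _.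
rewrite ler_wpM2r ?weight_ge0//.
rewrite (_ : 4 / c * _ = (8 * source_const R * eps ^+ 3) / c * (eps / 8)); last first.
  by field; rewrite gt_eqF.
apply: (@le_trans _ _ (eps / 8)); last by have := ltW eps0; lra.
by rewrite ler_piMl ?divr_ge0 ?(ltW eps0)// ler_pdivrMr// mul1r.
Qed.

(** The product of 4 / c from [green_bound] with the Lipschitz constant of the source must be at
    most 1/2; this dictates the factor 8 in [small]. *)
Lemma fixmap_halving : halving weight admissible fixmap.
Proof.
move=> g1 g2 D a1 a2 D0 gD y; have e0 := ltW eps0.
have c1 := continuous_source a1; have c2 := continuous_source a2.
rewrite /fixmap -(greenB c0 _ c1 c2 (exp_bounded_source a1) (exp_bounded_source a2)).
have cd : continuous (fun s => source g1 s - source g2 s).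
  by move=> s; apply: cvgB; [exact: c1|exact: c2].
have bd : exp_bounded (source_const R * eps ^+ 3 * D) 2^-1 (fun s => source g1 s - source g2 s).
  move=> s; apply: le_trans (source_diff s a1 a2 D0 gD) _.
  by rewrite ler_wpM2l ?weight_le_expR// !mulr_ge0 ?source_const_ge0// exprn_ge0.
apply: le_trans (green_bound c0 `|y| cd bd) _.
rewrite ler_wpM2r ?weight_ge0//.
rewrite (_ : 4 / c * _ = (8 * source_const R * eps ^+ 3) / c * (D / 2)); last by field; rewrite gt_eqF.
by rewrite ler_piMl ?divr_ge0// ler_pdivrMr// mul1r.
Qed.

(** The derivative of [green] is at most twice the bound on the source, uniformly in [g], and the
    absolute value is 1-Lipschitz. *)
Lemma fixmap_lipschitz g x y : admissible g ->
  `|fixmap g x - fixmap g y| <= source_const R / 2 * eps ^+ 4 * `|x - y|.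
Proof.
move=> ag; have e0 := ltW eps0.
have H := lipschitz_halfline (fun z => is_derive_green c0 z (continuous_source ag) (exp_bounded_source ag)).
apply: le_trans (H (source_const R / 2 * eps ^+ 4) _ _ _ _ _) _ => //.
- move=> z z0.
  apply: le_trans (dgreen_bound c0 z (continuous_source ag) (exp_bounded_source ag)) _.
  rewrite (_ : 2 * _ = source_const R / 2 * eps ^+ 4); last by field.
  rewrite ler_piMr ?mulr_ge0 ?exprn_ge0 ?source_const_ge0// expR_le1.
  by rewrite mulNr oppr_le0 mulr_ge0// invr_ge0.
- by rewrite ler_wpM2l ?mulr_ge0 ?exprn_ge0 ?source_const_ge0// ler_dist_dist.
Qed.

Lemma fixmap_fixpoint : exists2 g, admissible g & fixmap g =1 g.
Proof.
have e0 := ltW eps0; have A0 : 0 <= eps / 4 by rewrite divr_ge0.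
(* Continuity is not preserved by pointwise limits; a common Lipschitz constant is, and [fixmap]
   preserves it too. *)
pose X g := (forall y, `|g y| <= eps / 4 * weight y) /\
  (forall x y, `|g x - g y| <= source_const R / 2 * eps ^+ 4 * `|x - y|).
have XA g : X g -> admissible g by case=> b /continuous_lipschitz.
have [|||||g Xg fg] := @halving_fixpoint _ weight _ weight_ge0 A0 X fixmap (cst 0).
- by move=> g1 g2 D /XA a1 /XA a2; exact: fixmap_halving.
- split; first exact: admissible0.2.
  by move=> x y; rewrite subrr normr0 !mulr_ge0 ?source_const_ge0// exprn_ge0.
- move=> g /XA ag; split=> *; [exact: fixmap_bound|exact: fixmap_lipschitz].
- by move=> g [].
- move=> u g Xu ug; split=> [y|x y].
    apply: (ler_cvg_to (cvg_norm (ug y)) (cvg_cst _)).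
    by near=> n; exact: (Xu n).1.
  apply: (ler_cvg_to (cvg_norm (cvgB (ug x) (ug y))) (cvg_cst _)).
  by near=> n; exact: (Xu n).2.
by exists g => //; exact: XA.
Unshelve. all: by end_near. Qed.

End FixedPointMap.

(** * Fixed points are solutions *)

Section Existence.
Context {R : realType} (c eps : R) (g : R -> R).
Hypotheses (c0 : 0 < c) (eps0 : 0 < eps).
Hypotheses (ag : admissible eps g) (fixg : fixmap c eps g =1 g).
Implicit Types (x y : R).
Local Notation f := (profile eps g).
Local Notation F := (source eps g).
Local Notation p := (dgreen c F).
Local Notation slope := (source_const R / 2 * eps ^+ 4).
Local Notation height := (source_const R / 4 * eps ^+ 4).

Let e0 : 0 <= eps. Proof. exact: ltW. Qed.
Let contF : continuous F. Proof. exact: continuous_source. Qed.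
Let boundF : exp_bounded height 2^-1 F. Proof. exact: exp_bounded_source. Qed.

Let slope_ge0 : 0 <= slope.
Proof. by rewrite !mulr_ge0 ?source_const_ge0 ?exprn_ge0// invr_ge0. Qed.

Let height_ge0 : 0 <= height.
Proof. by rewrite !mulr_ge0 ?source_const_ge0 ?exprn_ge0// invr_ge0. Qed.

(** [fixmap] evaluates [green] at [|y|], so this identity, and the derivatives drawn from it, belong
    to the open half-line. *)
Lemma profile_green y : 0 < y -> eps - g 0 + green c F y = f y.
Proof. by move=> y0; rewrite /profile -[in RHS](fixg y) /fixmap gtr0_norm. Qed.

Lemma is_derive_profile y : 0 < y -> is_derive y 1 f (p y).
Proof.
move=> y0.
have E : \forall z \near y, (cst (eps - g 0) + green c F) z = f z.
  near=> z; apply: profile_green; near: z; exact: (cvgr_gt y cvg_id).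
apply: (near_eq_is_derive E).
apply: is_derive_eq (is_deriveD (is_derive_cst _ y 1) (is_derive_green c0 y contF boundF)) _.
by rewrite add0r.
Unshelve. all: by end_near. Qed.

Lemma derive1_profile y : 0 < y -> derive1 f y = p y.
Proof. by move=> y0; have D := is_derive_profile y0; rewrite derive1E derive_val. Qed.

Lemma is_derive_derive1_profile y : 0 < y -> is_derive y 1 (derive1 f) (c * p y + F y).
Proof.
move=> y0.
have E : \forall z \near y, p z = derive1 f z.
  near=> z; apply/esym/derive1_profile; near: z; exact: (cvgr_gt y cvg_id).
exact: (near_eq_is_derive E (is_derive_dgreen c0 y contF boundF)).
Unshelve. all: by end_near. Qed.

Lemma derive2_profile y : 0 < y -> derive1 (derive1 f) y = c * p y + F y.
Proof. by move=> y0; have D := is_derive_derive1_profile y0; rewrite derive1E derive_val. Qed.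

Lemma norm_slope y : 0 <= y -> `|p y| <= slope.
Proof.
move=> y0; apply: le_trans (dgreen_bound c0 y contF boundF) _.
rewrite (_ : 2 * height = slope); last by field.
by rewrite ler_piMr// expR_le1 mulNr oppr_le0 mulr_ge0// invr_ge0.
Qed.

Lemma norm_source y : `|F y| <= height.
Proof. by apply: le_trans (source_bound eps0 y ag) _; rewrite ler_piMr// weight_le1. Qed.

Lemma norm_derive2 y : 0 <= y -> `|c * p y + F y| <= c * slope + height.
Proof.
move=> y0; apply: le_trans (ler_normD _ _) _; apply: lerD; last exact: norm_source.
by rewrite normrM gtr0_norm// ler_wpM2l ?norm_slope// ltW.
Qed.

Lemma slope_holder x y : 0 <= x -> 0 <= y ->
  `|p x - p y| <= (c * slope + height + 2 * slope) * Num.sqrt `|x - y|.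
Proof.
move=> x0 y0; apply: lipschitz_bounded_holder => //.
- by rewrite addr_ge0// mulr_ge0// ltW.
- by rewrite mulr_ge0.
- apply: (lipschitz_halfline (fun z => is_derive_dgreen c0 z contF boundF)) => //.
  exact: norm_derive2.
- apply: le_trans (ler_normB _ _) _.
  by have := norm_slope x0; have := norm_slope y0; lra.
Qed.

(** As a fixed point, [g] inherits the Lipschitz constant of [fixmap]; the factor [cubesum] is at
    most [4 * (2 * eps) ^+ 3]. *)
Lemma emission_holder x y :
  `|emission eps g x - emission eps g y| <=
  (32 * eps ^+ 3 * slope + 32 * eps ^+ 4) * Num.sqrt `|x - y|.
Proof.
apply: lipschitz_bounded_holder => //.
- by rewrite mulr_ge0// mulr_ge0// exprn_ge0.
- by rewrite mulr_ge0// exprn_ge0.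
- have -> : emission eps g x - emission eps g y = (f x - f y) * cubesum (f x) (f y).
    by rewrite /emission /cubesum; ring.
  rewrite normrM mulrC.
  rewrite (_ : _ * _ * `|x - y| = 4 * (2 * eps) ^+ 3 * (slope * `|x - y|)); last by ring.
  apply: ler_pM => //; first by apply: norm_cubesum; exact: norm_profile.
  rewrite (_ : f x - f y = g x - g y); last by rewrite /profile; ring.
  by rewrite -!fixg; exact: fixmap_lipschitz.
- apply: le_trans (ler_normB _ _) _.
  by have := norm_emission eps0 x ag; have := norm_emission eps0 y ag; lra.
Qed.

Lemma source_holder x y : 0 <= x -> 0 <= y ->
  `|F x - F y| <= (32 * eps ^+ 3 * slope + 32 * eps ^+ 4 + 48 * eps ^+ 4) * Num.sqrt `|x - y|.
Proof.
move=> x0 y0; rewrite /source (ger0_norm x0) (ger0_norm y0).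
have rearrange (a b a' b' : R) : a - b - (a' - b') = (a - a') - (b - b') by ring.
rewrite rearrange.
apply: le_trans (ler_normB _ _) _; rewrite [leRHS]mulrDl; apply: lerD.
- exact: emission_holder.
- exact: halfconv_emission_holder.
Qed.

Lemma C2half_profile : C2half f.
Proof.
split; first by apply: continuous_subspaceT; exact: continuous_profile ag.
split.
  by move=> y y0; split; [case: (is_derive_profile y0)|case: (is_derive_derive1_profile y0)].
(* The second derivative is [c * p + F], so its Hoelder constant is [c] times that of [p] plus that
   of [F]. *)
pose H := c * (c * slope + height + 2 * slope) +
  (32 * eps ^+ 3 * slope + 32 * eps ^+ 4 + 48 * eps ^+ 4).
have H0 : 0 <= H.
  rewrite /H addr_ge0//.
    rewrite mulr_ge0 ?(ltW c0)// addr_ge0//; last by rewrite mulr_ge0.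
    by rewrite addr_ge0// mulr_ge0// ltW.
  rewrite addr_ge0//; last by rewrite mulr_ge0// exprn_ge0.
  rewrite addr_ge0//; last by rewrite mulr_ge0// exprn_ge0.
  by rewrite mulr_ge0// mulr_ge0// exprn_ge0.
pose N := c * slope + height.
have N0 : 0 <= N by rewrite addr_ge0// mulr_ge0// ltW.
exists (2 * eps + slope + N + H); split; [|split].
- move=> y y0; apply: le_trans (norm_profile eps0 y ag) _.
  by move: slope_ge0 N0 H0; lra.
- move=> y y0; rewrite derive2_profile// derive1_profile//; split.
  + apply: le_trans (norm_slope (ltW y0)) _.
    by move: e0 N0 H0; lra.
  + apply: le_trans (norm_derive2 (ltW y0)) _; rewrite -/N.
    by move: e0 slope_ge0 H0; lra.
- move=> x y x0 y0; rewrite !derive2_profile//.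
  apply: (@le_trans _ _ (H * Num.sqrt `|x - y|)); last first.
    by rewrite ler_wpM2r ?sqrtr_ge0//; move: e0 slope_ge0 N0; lra.
  have rearrange (a b a' b' : R) : c * a + b - (c * a' + b') = c * (a - a') + (b - b').
    by ring.
  rewrite rearrange.
  apply: le_trans (ler_normD _ _) _; rewrite /H [leRHS]mulrDl; apply: lerD.
  + rewrite normrM gtr0_norm// -mulrA ler_wpM2l ?(ltW c0)//.
    by apply: slope_holder; exact: ltW.
  + by apply: source_holder; exact: ltW.
Qed.

Lemma solves_profile : solves_problem c eps f.
Proof.
split; first exact: C2half_profile.
split.
  move=> y y0; rewrite derive2_profile// derive1_profile//.
  have -> : (\int[@lebesgue_measure R]_(eta in `[0%R, +oo[)
      (Ekernel (y - eta) * (f eta ^+ 4)%:E) = (halfconv (emission eps g) y)%:E)%E.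
    by apply: halfconvE; [exact: measurable_emission|move=> eta _; exact: norm_emission].
  rewrite -EFinN; congr (_%:E).
  by rewrite {2}/source gtr0_norm// /emission; ring.
split; first by rewrite /profile subrK.
by move=> y _; have /andP[h _] := profile_bounds eps0 y ag; apply: le_trans h; rewrite divr_ge0.
Qed.

Lemma cvg_profile : f x @[x --> +oo] --> eps - g 0.
Proof.
rewrite -[X in _ --> X]addr0; apply: cvgD; first exact: cvg_cst.
have K0 : eps / 4 * expR (- 2^-1 * x) @[x --> +oo] --> (0 : R).
  rewrite -[X in _ --> X](mulr0 (eps / 4)).
  by apply: cvgM; [exact: cvg_cst|apply: cvg_expRZ_pinfty; rewrite invr_gt0].
have K1 : - (eps / 4 * expR (- 2^-1 * x)) @[x --> +oo] --> (0 : R).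
  by rewrite -[X in _ --> X]oppr0; exact: cvgN K0.
apply: (squeeze_cvgr _ K1 K0); near=> x; rewrite -ler_norml.
apply: le_trans (ag.2 x) _; rewrite ler_wpM2l ?weight_le_expR// divr_ge0//.
Unshelve. all: by end_near. Qed.

End Existence.

(** * Solutions are fixed points *)

Section Uniqueness.
Context {R : realType} (c eps : R).
Hypotheses (c0 : 0 < c) (eps0 : 0 < eps).

(** The decay hypothesis is membership in the ball, and the bound on u' contained in [C2half]
    excludes the growing exponential, so [bounded_solution_green] applies. *)
Lemma solution_fixpoint (u : R -> R) (l : R) : solves_problem c eps u ->
  u x @[x --> +oo] --> l ->
  (forall y, 0 <= y -> `|u y - l| <= eps / 4 * expR (- y / 2)) ->
  admissible eps (fun y => u `|y| - l) /\
  fixmap c eps (fun y => u `|y| - l) =1 (fun y => u `|y| - l).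
Proof.
move=> [[cu [du [M [_ [du_bd _]]]]] [ode [u0 _]]] ul udecay.
set k := fun y => u `|y| - l.
(* Only one-sided continuity at 0 is given; for the even extension it becomes two-sided. *)
have cabs : continuous (fun y : R => u `|y|).
  have /continuous_within_itvcyP[cu1 cu2] := cu.
  move=> y; have [->|yn0] := eqVneq y 0; last first.
    apply: (@continuous_comp _ _ _ (fun y : R => `|y|) u); first exact: norm_continuous.
    by apply: cu1; rewrite in_itv/= andbT normr_gt0.
  rewrite /continuous_at normr0; apply/cvgrPdist_lt => e e1.
  have /cvgrPdist_lt/(_ e e1) := cu2.
  rewrite /at_right near_withinE => H.
  have : \forall z \near (0 : R), 0 < `|z| -> `|u 0 - u `|z| | < e.
    have C : `|z| @[z --> (0 : R)] --> (0 : R).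
      by have := @norm_continuous _ R 0; rewrite /continuous_at normr0.
    exact: (C _ H).
  apply: filterS => z hz; have [->|z0] := eqVneq z 0; first by rewrite normr0 subrr normr0.
  by apply: hz; rewrite normr_gt0.
have ak : admissible eps k.
  split; first by move=> y; apply: cvgB; [exact: cabs|exact: cvg_cst].
  move=> y; apply: le_trans (udecay _ (normr_ge0 y)) _.
  by rewrite /weight (_ : - `|y| / 2 = - 2^-1 * `|y|)//; ring.
split => //.
have prof y : profile eps k y = u `|y| by rewrite /profile /k normr0 u0; ring.
have cF := continuous_source eps0 ak; have bF := exp_bounded_source eps0 ak.
have ode' (y : R) : 0 < y -> is_derive y 1 (derive1 u) (c * derive1 u y + source eps k y).
  move=> y0; have [_ d2] := du y y0.
  suff -> : c * derive1 u y + source eps k y = derive1 (derive1 u) y.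
    by rewrite derive1E; exact: derivableP.
  have := ode y y0.
  have -> : (\int[@lebesgue_measure R]_(eta in `[0%R, +oo[)
      (Ekernel (y - eta) * (u eta ^+ 4)%:E) = (halfconv (emission eps k) y)%:E)%E.
    rewrite -(halfconvE y (measurable_emission ak) (fun eta _ => norm_emission eps0 eta ak)).
    apply: eq_integral => eta; rewrite inE/= in_itv/= andbT => eta0.
    by rewrite /emission prof ger0_norm.
  rewrite -EFinN => -[e].
  rewrite /source (gtr0_norm y0) {1}/emission prof (gtr0_norm y0).
  by move: e; lra.
have du1 (y : R) : 0 < y -> is_derive y 1 u (derive1 u y).
  by move=> y0; have [d1 _] := du y y0; rewrite derive1E; exact: derivableP.
have main := bounded_solution_green c0 cF bF du1 ode' (fun y y0 => (du_bd y y0).1) ul.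
have fixpos y : 0 < y -> fixmap c eps k y = k y.
  by move=> y0; rewrite /fixmap /k (gtr0_norm y0) (main y y0) addrC addKr.
move=> y; rewrite -[fixmap _ _ _ y](_ : fixmap c eps k `|y| = _); last first.
  by rewrite /fixmap normr_id.
rewrite -[RHS](_ : k `|y| = _); last by rewrite /k normr_id.
(* The equation is available for y > 0 only; at 0 both sides are continuous and agree as limits from
   the right. *)
have [->|yn0] := eqVneq y 0; last by apply: fixpos; rewrite normr_gt0.
rewrite normr0.
have L1 : fixmap c eps k z @[z --> 0^'+] --> fixmap c eps k 0.
  apply: cvg_at_right_filter.
  apply: (@continuous_lipschitz _ (fixmap c eps k) (source_const R / 2 * eps ^+ 4)).
  by move=> x z; exact: fixmap_lipschitz.
have L2 : k z @[z --> 0^'+] --> k 0.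
  by apply: cvg_at_right_filter; exact: ak.1.
have L3 : fixmap c eps k z @[z --> 0^'+] --> k 0.
  apply: cvg_trans L2; apply: near_eq_cvg; near=> z; apply/esym/fixpos.
  by near: z; exact: nbhs_right_gt.
exact: (cvg_unique _ L1 L3).
Unshelve. all: by end_near. Qed.

End Uniqueness.

Theorem theorem2p10 (R : realType) (c : R) (hc : 0 < c) :
  exists eps0 : R, 0 < eps0 /\
  forall eps : R, 0 < eps -> eps < eps0 ->
  exists A c0 : R, 0 < A /\ 0 < c0 < 1 /\
  exists (f : R -> R) (finf : R),
    solves_problem c eps f /\
    (f x @[x --> +oo] --> finf) /\
    (forall y : R, 0 <= y -> `|f y - finf| <= A * expR (- y / 2)) /\
    (forall y : R, 0 <= y -> c0 * eps <= f y) /\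
    c0 * eps <= finf /\
    (forall (g : R -> R) (ginf : R),
        solves_problem c eps g ->
        (g x @[x --> +oo] --> ginf) ->
        (forall y : R, 0 <= y -> `|g y - ginf| <= A * expR (- y / 2)) ->
        forall y : R, 0 <= y -> g y = f y).
Proof.
have K0 : 0 < 8 * source_const R + 1 by have := source_const_ge0 R; lra.
(* The minimum with 1 gives [eps ^+ 3 <= eps], which reduces [small] to a linear condition; the
   added 1 keeps the denominator positive. *)
exists (Num.min 1 (c / (8 * source_const R + 1))); split.
  by rewrite lt_min ltr01 divr_gt0.
move=> eps eps0; rewrite lt_min ltr_pdivlMr// => /andP[eps1 epsc].
have small : 8 * source_const R * eps ^+ 3 <= c.
  have e3 : eps ^+ 3 <= eps.
    by rewrite -[leRHS]expr1 ler_wiXn2l// ltW.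
  have := source_const_ge0 R; have := ltW eps0 => h1 h2.
  apply: le_trans (ltW epsc); rewrite mulrC; apply: ler_pM => //.
  - exact: exprn_ge0.
  - by rewrite mulr_ge0.
  - by rewrite lerDl.
have [g ag fixg] := fixmap_fixpoint hc eps0 small.
(* A is the radius of the ball; c0 = 1/2 comes from the lower bound of [profile_bounds], and the
   limit [eps - g 0] is at least 3 eps / 4. *)
exists (eps / 4), 2^-1; split; first by rewrite divr_gt0.
split; first by apply/andP; split; lra.
exists (profile eps g), (eps - g 0); split; first exact: solves_profile.
split; first exact: cvg_profile.
have finfE y : profile eps g y - (eps - g 0) = g y by rewrite /profile; ring.
split.
  move=> y y0; rewrite finfE (_ : - y / 2 = - 2^-1 * `|y|); first exact: ag.2.
  by rewrite ger0_norm//; ring.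
split.
  by move=> y _; have /andP[h _] := profile_bounds eps0 y ag; rewrite mulrC.
split.
  by have := admissible_le eps0 0 ag; rewrite ler_norml => /andP[h1 h2]; lra.
move=> u l solu ul udecay y y0.
have [ak fixk] := solution_fixpoint hc eps0 solu ul udecay.
have A0 : 0 <= eps / 4 by rewrite divr_ge0// ltW.
have E := halving_fixpoint_unique A0 (fixmap_halving hc eps0 small)
  ak ag ak.2 ag.2 fixk fixg.
have u0 : u 0 = eps by case: solu => _ [_ []].
(* [E] at 0 gives [u 0 - l = g 0], so with the common boundary value the two limits coincide and
   cancel. *)
rewrite /profile -!E normr0 u0 ger0_norm//; ring.
Qed.
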